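(* Let $(M_j,\tau_j)$, $j=1,2$, be algebraically sofic tracial von Neumann algebras, and let $q\in(0,1)\cap\mathbb Q$. Let $M=M_1\oplus M_2$ be equipped with the trace $\tau(a_1,a_2)=q\,\tau_1(a_1)+(1-q)\,\tau_2(a_2)$. Then $(M,\tau)$ is algebraically sofic. In particular, every finite dimensional tracial von Neumann algebra in which every central projection has trace in $\mathbb Q$ is algebraically sofic.
   Context: A tracial von Neumann algebra $(M,\tau)$ is a von Neumann algebra with a faithful normal tracial state. Let $\mathrm{tr}_n$ be the normalized trace on $M_n(\mathbb C)$, $\|a\|_2=\mathrm{tr}_n(a^*a)^{1/2}$, and let $\mathrm{Gal}(\overline{\mathbb Q}/\mathbb Q)$ be the group of all field automorphisms of the field $\overline{\mathbb Q}\subseteq\mathbb C$ of algebraic numbers, acting entrywise on matrices. A sequence $X^{(k)}\in M_{n(k)}(\mathbb C)$ is Galois bounded if all entries of all $X^{(k)}$ are algebraic integers, $\sup_k\max_{\sigma\in\mathrm{Gal}(\overline{\mathbb Q}/\mathbb Q)}\|\sigma(X^{(k)})\|<\infty$, and $\sup_k\#\{\sigma(X^{(k)}):\sigma\in\mathrm{Gal}(\overline{\mathbb Q}/\mathbb Q)\}<\infty$; a sequence of finite tuples is Galois bounded if each coordinate sequence is. Matrices $X^{(k)}\in M_{n(k)}(\mathbb C)^F$ ($F$ finite) are microstates for $x\in M^F$ if $\mathrm{tr}_{n(k)}(P(X^{(k)}))\to\tau(P(x))$ for every noncommutative $*$-polynomial $P$ over $\mathbb C$. A sequence $Y^{(k)}\in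 M_{n(k)}(\mathbb C)$ is asymptotically constant on the diagonal if $\|\Delta_{n(k)}(Y^{(k)})-\mathrm{tr}_{n(k)}(Y^{(k)})1\|_2\to0$, where $\Delta_n$ is the conditional expectation onto the diagonal matrices. A tuple $x=(x_i)_{i\in I}\in M^I$ ($I$ any set) is algebraically sofic if for every finite $F\subseteq I$ there is a Galois bounded sequence of microstates $X^{(k)}$ for $x|_F$ such that $P(X^{(k)})$ is asymptotically constant on the diagonal for every $*$-polynomial $P$. $(M,\tau)$ is algebraically sofic if it has an algebraically sofic tuple generating it as a von Neumann algebra. *)

(* Defs.v *)
From HB Require Import structures.
From mathcomp Require Import all_boot all_order all_algebra.
From mathcomp Require Import all_classical all_reals all_analysis.
From mathcomp.real_closed Require Import complex.

Set Implicit Arguments.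
Unset Strict Implicit.
Unset Printing Implicit Defensive.

Import Order.TTheory GRing.Theory Num.Theory Num.Def.
Import numFieldNormedType.Exports.

Local Open Scope classical_set_scope.
Local Open Scope ring_scope.
Local Open Scope sesquilinear_scope.

(* The complex numbers are [R[i]] for [R : realType]; the order of [R[i]] is   *)
(* the partial one, so [0 <= z] means that [z] is real and nonnegative.        *)

Definition dot_norm (R : realType) (U : lmodType R[i])
  (form : {dot U for conjC}) (u : U) : R[i] := sqrtC (form u u).

(* The inner product is linear in its first argument. *)
Record hilbert (R : realType) := Hilbert {
  hcarrier :> lmodType R[i];
  hdot : {dot hcarrier for conjC};
  hcomplete : forall u : nat -> hcarrier,
    (forall e : R[i], 0 < e -> exists N : nat, forall m n : nat,
       (N <= m)%N -> (N <= n)%N -> dot_norm hdot (u m - u n) < e) ->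
    exists l : hcarrier, forall e : R[i], 0 < e -> exists N : nat,
      forall n : nat, (N <= n)%N -> dot_norm hdot (u n - l) < e
}.

Definition hnorm (R : realType) (H : hilbert R) (v : H) : R[i] :=
  dot_norm (hdot H) v.

Definition bounded_op (R : realType) (H : hilbert R) (T : H -> H) : Prop :=
  linear T /\ exists2 c : R[i], 0 <= c & forall v, hnorm (T v) <= c * hnorm v.

Definition adjoint_op (R : realType) (H : hilbert R) (T S : H -> H) : Prop :=
  forall u v, hdot H (T u) v = hdot H u (S v).

Definition commutant (R : realType) (H : hilbert R) (N : set (H -> H)) :
    set (H -> H) :=
  [set T | bounded_op T /\ forall S, N S -> T \o S = S \o T].

(* A bicommutant is automatically a unital algebra of bounded operators. *)
Definition von_neumann_algebra (R : realType) (H : hilbert R)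
    (N : set (H -> H)) : Prop :=
  (forall T, N T -> exists2 S, N S & adjoint_op T S) /\
  commutant (commutant N) = N.

(* A von Neumann algebra is presented as an algebra [M] over the complex       *)
(* numbers together with an injective unital representation [vn_rep] that      *)
(* identifies it with a von Neumann algebra of operators on [vn_space]. The    *)
(* axioms of an involution for [vn_star] follow from [vn_rep_star] and         *)
(* [vn_rep_inj].                                                               *)
Record vnAlg (R : realType) := VnAlg {
  vn_alg :> algType R[i];
  vn_star : vn_alg -> vn_alg;
  vn_space : hilbert R;
  vn_rep : vn_alg -> vn_space -> vn_space;
  vn_rep_linear : forall (c : R[i]) (a b : vn_alg) (v : vn_space),
    vn_rep (c *: a + b) v = c *: vn_rep a v + vn_rep b v;
  vn_rep_one : forall v, vn_rep 1 v = v;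
  vn_rep_mul : forall a b v, vn_rep (a * b) v = vn_rep a (vn_rep b v);
  vn_rep_star : forall a, adjoint_op (vn_rep a) (vn_rep (vn_star a));
  vn_rep_inj : injective vn_rep;
  vn_rep_vna : von_neumann_algebra (range vn_rep)
}.

Definition vn_le (R : realType) (M : vnAlg R) (a b : M) : Prop :=
  forall v : vn_space M, 0 <= hdot (vn_space M) (vn_rep (b - a) v) v.

Definition directed (R : realType) (M : vnAlg R) (D : set M) : Prop :=
  D !=set0 /\ forall a b, D a -> D b ->
    exists c, [/\ D c, vn_le a c & vn_le b c].

Definition is_vn_sup (R : realType) (M : vnAlg R) (D : set M) (s : M) : Prop :=
  (forall a, D a -> vn_le a s) /\
  (forall b, (forall a, D a -> vn_le a b) -> vn_le s b).

(* The ranges of increasing nets are the directed sets, so nets are not needed. *)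
Definition normal (R : realType) (M : vnAlg R) (t : M -> R[i]) : Prop :=
  forall (D : set M) (s : M),
    directed D -> (forall a, D a -> vn_star a = a) -> is_vn_sup D s ->
    (forall a, D a -> t a <= t s) /\
    (forall c : R[i], (forall a, D a -> t a <= c) -> t s <= c).

Record tracialVnAlg (R : realType) := TracialVnAlg {
  tvn :> vnAlg R;
  tau : tvn -> R[i];
  tau_linear : forall (c : R[i]) (a b : tvn),
    tau (c *: a + b) = c * tau a + tau b;
  tau_one : tau 1 = 1;
  tau_pos : forall a : tvn, vn_le 0 a -> 0 <= tau a;
  tau_faithful : forall a : tvn, tau (vn_star a * a) = 0 -> a = 0;
  tau_trace : forall a b : tvn, tau (a * b) = tau (b * a);
  tau_normal : normal tau
}.

Definition generates (R : realType) (M : vnAlg R) (I : Type) (x : I -> M) :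
    Prop :=
  forall N : set (vn_space M -> vn_space M), von_neumann_algebra N ->
    (forall i, N (vn_rep (x i))) -> range (@vn_rep R M) `<=` N.

Definition finite_dimensional (K : fieldType) (V : lmodType K) : Prop :=
  exists (n : nat) (e : 'I_n -> V), forall v : V,
    exists c : 'I_n -> K, v = \sum_(i < n) c i *: e i.

Definition central_projection (R : realType) (M : vnAlg R) (p : M) : Prop :=
  [/\ vn_star p = p, p * p = p & forall a : M, p * a = a * p].

(* A *-polynomial in the variables [I] is a list of terms, each made of a      *)
(* coefficient and a word in the letters [(i, false)] for the variable [i] and *)
(* [(i, true)] for its adjoint.                                                *)
Definition starpoly (K I : Type) := seq (K * seq (I * bool)).

Definition starpoly_eval (K : fieldType) (A : algType K) (star : A -> A)
    (I : Type) (x : I -> A) (P : starpoly K I) : A :=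
  \sum_(t <- P) t.1 *: \prod_(l <- t.2) (if l.2 then star (x l.1) else x l.1).

Section Matrices.
Variable R : realType.
Local Notation C := R[i].

Definition ntr n (A : 'M[C]_n) : C := \tr A / n%:R.

Definition norm2 n (A : 'M[C]_n) : C := sqrtC (ntr (A^t* *m A)).

Definition diag_part n (A : 'M[C]_n) : 'M[C]_n := diag_mx (\row_i A i i).

Definition vnorm n (v : 'cV[C]_n) : R :=
  Num.sqrt (\sum_i Normc.normc (v i 0) ^+ 2).

Definition opnorm n (A : 'M[C]_n) : R :=
  sup [set vnorm (A *m v) | v in [set v : 'cV[C]_n | vnorm v <= 1]].

Definition mx_eval n (I : Type) (X : I -> 'M[C]_n.+1) (P : starpoly C I) :
    'M[C]_n.+1 :=
  starpoly_eval (fun A : 'M[C]_n.+1 => A^t*) X P.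

End Matrices.

Definition tends_to (K : numFieldType) (u : nat -> K) (l : K) : Prop :=
  u @ \oo --> l.

Section Galois.
Variable R : realType.
Local Notation C := R[i].

Definition Qbar : set C := [set z | algebraicOver (ratr : rat -> C) z].

Definition algebraic_integer (z : C) : Prop := integralOver (intr : int -> C) z.

(* The field automorphisms of [Qbar]: a function in [Gal] represents its       *)
(* restriction to [Qbar], and its values elsewhere are irrelevant.             *)
Definition Gal : set (C -> C) := [set s |
  [/\ set_bij Qbar Qbar s,
      forall x y, Qbar x -> Qbar y -> s (x + y) = s x + s y &
      forall x y, Qbar x -> Qbar y -> s (x * y) = s x * s y]].

(* The normalized trace needs matrices of positive size, hence the [(n k).+1]. *)
Definition galois_bounded (n : nat -> nat) (X : forall k, 'M[C]_((n k).+1)) :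
    Prop :=
  [/\ forall k i j, algebraic_integer (X k i j),
      exists B : R, forall k s, Gal s -> opnorm (map_mx s (X k)) <= B &
      exists N : nat, forall k, ([set map_mx s (X k) | s in Gal] #<= `I_N)%card].

End Galois.

Section Sofic.
Variable R : realType.
Local Notation C := R[i].

Definition microstates (M : tracialVnAlg R) (F : Type) (x : F -> M)
    (n : nat -> nat) (X : forall k, F -> 'M[C]_((n k).+1)) : Prop :=
  forall P : starpoly C F,
    tends_to (fun k => ntr (mx_eval (X k) P))
      (tau (starpoly_eval (@vn_star R M) x P)).

Definition asymptotically_constant (n : nat -> nat)
    (Y : forall k, 'M[C]_((n k).+1)) : Prop :=
  tends_to (fun k => norm2 (diag_part (Y k) - (ntr (Y k))%:M)) 0.

Definition algebraically_sofic_tuple (M : tracialVnAlg R) (I : Type)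
    (x : I -> M) : Prop :=
  forall F : set I, finite_set F ->
    exists (n : nat -> nat) (X : forall k, F -> 'M[C]_((n k).+1)),
      [/\ forall i : F, galois_bounded (fun k => X k i),
          microstates (fun i : F => x (\val i)) X &
          forall P : starpoly C F,
            asymptotically_constant (fun k => mx_eval (X k) P)].

Definition algebraically_sofic (M : tracialVnAlg R) : Prop :=
  exists (I : Type) (x : I -> M), generates x /\ algebraically_sofic_tuple x.

End Sofic.

Section HilbertSum.
Variables (R : realType) (H1 H2 : hilbert R).
Local Notation C := R[i].
Local Notation U := (hcarrier H1 * hcarrier H2)%type.

Definition sum_dot (u v : U) : C := hdot H1 u.1 v.1 + hdot H2 u.2 v.2.

Lemma sum_dot_bilinear :
  bilinear_for (GRing.Scale.Law.clone _ _ *%R _)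
    (GRing.Scale.Law.clone _ _ (conjC \; *%R) _) sum_dot.
Proof.
split=> u a v w; rewrite /sum_dot /=.
  by rewrite !linearPl /= mulrDr addrACA.
by rewrite !linearPr /= mulrDr addrACA.
Qed.
HB.instance Definition _ :=
  bilinear_isBilinear.Build C U U C _ _ sum_dot sum_dot_bilinear.

Lemma sum_dot_hermitian u v :
  sum_dot u v = (-1) ^+ false * (sum_dot v u)^*.
Proof.
by rewrite /sum_dot rmorphD /= (hermC (hdot H1)) (hermC (hdot H2)) /= mulrDr.
Qed.
HB.instance Definition _ :=
  isHermitianSesquilinear.Build C U false conjC sum_dot sum_dot_hermitian.

Lemma sum_dot_pos u : u != 0 -> 0 < sum_dot u u.
Proof.
case: u => u1 u2 u0; rewrite /sum_dot /=.
have [u10|u10] := eqVneq u1 0.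
  rewrite u10 linear0r add0r dnorm_gt0; apply: contraNneq u0 => ->.
  by rewrite u10.
by rewrite ltr_wpDr ?dnorm_ge0// dnorm_gt0.
Qed.
HB.instance Definition _ := isDotProduct.Build C U sum_dot sum_dot_pos.


Let sum_form : {dot U for conjC} := sum_dot.

Lemma dot_norm_suml u : dot_norm (hdot H1) u.1 <= dot_norm sum_form u.
Proof. by rewrite ler_sqrtC ?nnegrE ?dnorm_ge0// lerDl dnorm_ge0. Qed.

Lemma dot_norm_sumr u : dot_norm (hdot H2) u.2 <= dot_norm sum_form u.
Proof. by rewrite ler_sqrtC ?nnegrE ?dnorm_ge0// lerDr dnorm_ge0. Qed.

Lemma dot_norm_sum_le u :
  dot_norm sum_form u <= dot_norm (hdot H1) u.1 + dot_norm (hdot H2) u.2.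
Proof.
have h1 := sqrt_dnorm_ge0 (hdot H1) u.1; have h2 := sqrt_dnorm_ge0 (hdot H2) u.2.
rewrite -(@ler_pXn2r _ 2)// ?nnegrE ?sqrt_dnorm_ge0 ?addr_ge0// sqrtCK.
rewrite sqrrD !sqrtCK addrAC lerDl.
by rewrite mulrn_wge0// mulr_ge0.
Qed.

Lemma sum_complete (u : nat -> U) :
  (forall e : C, 0 < e -> exists N : nat, forall m n : nat,
     (N <= m)%N -> (N <= n)%N -> dot_norm sum_form (u m - u n) < e) ->
  exists l : U, forall e : C, 0 < e -> exists N : nat,
    forall n : nat, (N <= n)%N -> dot_norm sum_form (u n - l) < e.
Proof.
move=> cu.
have [e e0|l1 hl1] := @hcomplete _ H1 (fun n => (u n).1).
  have [N hN] := cu e e0; exists N => m n Nm Nn.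
  exact: le_lt_trans (dot_norm_suml (u m - u n)) (hN _ _ Nm Nn).
have [e e0|l2 hl2] := @hcomplete _ H2 (fun n => (u n).2).
  have [N hN] := cu e e0; exists N => m n Nm Nn.
  exact: le_lt_trans (dot_norm_sumr (u m - u n)) (hN _ _ Nm Nn).
exists (l1, l2) => e e0; have e2 : 0 < e / 2 by rewrite divr_gt0.
have [N1 h1] := hl1 _ e2; have [N2 h2] := hl2 _ e2.
exists (maxn N1 N2) => n; rewrite geq_max => /andP[n1 n2].
apply: le_lt_trans (dot_norm_sum_le _) _.
by rewrite [e]splitr ltrD// ?h1// h2.
Qed.

Definition hilbert_sum : hilbert R := @Hilbert R U sum_dot sum_complete.

Lemma hnorm_suml (u : hilbert_sum) : hnorm (u.1 : H1) <= hnorm u.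
Proof. exact: dot_norm_suml. Qed.

Lemma hnorm_sumr (u : hilbert_sum) : hnorm (u.2 : H2) <= hnorm u.
Proof. exact: dot_norm_sumr. Qed.

Lemma hnorm_sum_le (u : hilbert_sum) :
  hnorm u <= hnorm (u.1 : H1) + hnorm (u.2 : H2).
Proof. exact: dot_norm_sum_le. Qed.

Definition op_sum (T1 : H1 -> H1) (T2 : H2 -> H2) :
    hilbert_sum -> hilbert_sum := fun v => (T1 v.1, T2 v.2).

Lemma bounded_op_sum T1 T2 :
  bounded_op T1 -> bounded_op T2 -> bounded_op (op_sum T1 T2).
Proof.
move=> [l1 [c1 c10 h1]] [l2 [c2 c20 h2]]; split.
  by move=> a u v; rewrite /op_sum/= l1 l2.
exists (c1 + c2); first exact: addr_ge0.
move=> v; apply: le_trans (hnorm_sum_le _) _.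
rewrite mulrDl lerD//.
  by apply: le_trans (h1 _) _; rewrite ler_wpM2l// hnorm_suml.
by apply: le_trans (h2 _) _; rewrite ler_wpM2l// hnorm_sumr.
Qed.

End HilbertSum.

Lemma bounded_op_id (R : realType) (H : hilbert R) :
  bounded_op (fun v : H => v).
Proof. by split=> //; exists 1 => // v; rewrite mul1r. Qed.

Lemma bounded_op_0 (R : realType) (H : hilbert R) :
  bounded_op (fun _ : H => 0).
Proof.
split=> [a u v|]; first by rewrite scaler0 addr0.
by exists 0 => // v; rewrite /hnorm /dot_norm linear0r sqrtC0 mul0r.
Qed.

Section VnFacts.
Variables (R : realType) (M : vnAlg R).

Lemma vn_rep_bounded (a : M) : bounded_op (vn_rep a).
Proof.
suff : range (@vn_rep R M) (vn_rep a) by rewrite -(vn_rep_vna M).2 => -[].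
by exists a.
Qed.

Lemma vn_repB (a b : M) v : vn_rep (a - b) v = vn_rep a v - vn_rep b v.
Proof.
have := vn_rep_linear (-1) b a v.
by rewrite !scaleN1r addrC => ->; rewrite addrC.
Qed.

Lemma vn_rep0 v : vn_rep (0 : M) v = 0.
Proof. by rewrite -(subrr 0) vn_repB subrr. Qed.

Lemma vn_sq_ge0 (a : M) : vn_le 0 (vn_star a * a).
Proof.
move=> v; rewrite subr0 vn_rep_mul (hermC (hdot _)) /= -vn_rep_star.
by rewrite mul1r conjC_ge0 dnorm_ge0.
Qed.

End VnFacts.

Section TauFacts.
Variables (R : realType) (M : tracialVnAlg R).

Lemma tau_sq_ge0 (a : M) : 0 <= tau (vn_star a * a).
Proof. exact/tau_pos/vn_sq_ge0. Qed.

Lemma tau_le (a b : M) : vn_le a b -> tau a <= tau b.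
Proof.
move=> ab; have := tau_linear (-1) a b.
rewrite scaleN1r mulN1r addrC [RHS]addrC -subr_ge0 => <-.
by apply: tau_pos => v; rewrite subr0; exact: ab.
Qed.

End TauFacts.

Section VnSum.
Variables (R : realType) (M1 M2 : vnAlg R).
Local Notation C := R[i].
Local Notation A := (vn_alg M1 * vn_alg M2)%type.
Local Notation H := (hilbert_sum (vn_space M1) (vn_space M2)).

Definition sum_star (a : A) : A := (vn_star a.1, vn_star a.2).

Definition sum_rep (a : A) : H -> H := op_sum (vn_rep a.1) (vn_rep a.2).

Lemma sum_rep_linear (c : C) (a b : A) v :
  sum_rep (c *: a + b) v = c *: sum_rep a v + sum_rep b v.
Proof. by rewrite /sum_rep /op_sum /= !vn_rep_linear. Qed.

Lemma sum_rep_one v : sum_rep 1 v = v.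
Proof. by case: v => v1 v2; rewrite /sum_rep /op_sum /= !vn_rep_one. Qed.

Lemma sum_rep_mul a b v : sum_rep (a * b) v = sum_rep a (sum_rep b v).
Proof. by rewrite /sum_rep /op_sum /= !vn_rep_mul. Qed.

Lemma sum_rep_star a : adjoint_op (sum_rep a) (sum_rep (sum_star a)).
Proof. by move=> u v; rewrite /= /sum_dot /= !(vn_rep_star _ _ _). Qed.

Lemma sum_rep_inj : injective sum_rep.
Proof.
move=> [a1 a2] [b1 b2] e; congr pair; apply: vn_rep_inj; apply/funext => v.
  by have /(congr1 (fun f => (f (v, 0)).1)) := e.
by have /(congr1 (fun f => (f (0, v)).2)) := e.
Qed.

Lemma sum_commutant T1 T2 :
  commutant (range (@vn_rep R M1)) T1 -> commutant (range (@vn_rep R M2)) T2 ->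
  commutant (range sum_rep) (op_sum T1 T2).
Proof.
move=> [b1 c1] [b2 c2]; split; first exact: bounded_op_sum.
move=> _ [a _ <-]; apply/funext => v; rewrite /sum_rep /op_sum /=.
congr pair.
  by have /(congr1 (@^~ v.1)) := c1 (vn_rep a.1) (ex_intro2 _ _ _ I erefl).
by have /(congr1 (@^~ v.2)) := c2 (vn_rep a.2) (ex_intro2 _ _ _ I erefl).
Qed.

Lemma commutant_id (M : vnAlg R) : commutant (range (@vn_rep R M)) (fun v => v).
Proof. by split=> //; exact: bounded_op_id. Qed.

Lemma commutant_0 (M : vnAlg R) : commutant (range (@vn_rep R M)) (fun=> 0).
Proof.
split=> [|_ [a _ <-]]; first exact: bounded_op_0.
apply/funext => v /=.
have [l _] := vn_rep_bounded a.
by have := l 1 0 0; rewrite scale1r addr0 scale1r => /esym/eqP; rewrite -subr_eq0 addrK => /eqP.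
Qed.

Lemma sum_bicommutant : commutant (commutant (range sum_rep)) = range sum_rep.
Proof.
apply/seteqP; split => [T [bT cT]|_ [a _ <-]]; last first.
  split=> [|S [bS cS]].
    by apply: bounded_op_sum; exact: vn_rep_bounded.
  by rewrite cS//; exists a.
have [lT [c c0 hT]] := bT.
have T0 : T 0 = 0.
  have := lT 1 0 0; rewrite scale1r addr0 scale1r => /eqP.
  by rewrite -subr_eq0 opprD addNKr oppr_eq0 => /eqP.
have TD u v : T (u + v) = T u + T v by have := lT 1 u v; rewrite !scale1r.
have e1 := sum_commutant (commutant_id M1) (commutant_0 M2).
have T1E v : (T (v, 0)).2 = 0.
  by have /(congr1 (@^~ (v, 0))) := cT _ e1; rewrite /op_sum /= => ->.
have T2E v : (T (0, v)).1 = 0.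
  have /(congr1 (@^~ (0, v))) := cT _ e1.
  by rewrite /op_sum /= -[(0, 0)]/(0 : H) T0 => /(congr1 fst).
pose T1 v := (T (v, 0)).1; pose T2 v := (T (0, v)).2.
have [a1 _ a1E] : range (@vn_rep R M1) T1.
  rewrite -(vn_rep_vna M1).2; split; first split.
  - move=> a u v; rewrite /T1.
    have := lT a (u, 0) (v, 0); rewrite -[X in T X]/(a *: u + v, a *: 0 + 0).
    by rewrite scaler0 addr0 => ->.
  - exists c => // v; apply: le_trans (hnorm_suml (T (v, 0))) _.
    apply: le_trans (hT _) _; rewrite ler_wpM2l//.
    by rewrite /hnorm /dot_norm /= /sum_dot /= linear0r addr0.
  - move=> S cS; have := cT _ (sum_commutant cS (commutant_0 M2)).
    move=> cTS; apply/funext => v; have /(congr1 (@^~ (v, 0))) := cTS.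
    by rewrite /op_sum /= => /(congr1 fst).
have [a2 _ a2E] : range (@vn_rep R M2) T2.
  rewrite -(vn_rep_vna M2).2; split; first split.
  - move=> a u v; rewrite /T2.
    have := lT a (0, u) (0, v); rewrite -[X in T X]/(a *: 0 + 0, a *: u + v).
    by rewrite scaler0 addr0 => ->.
  - exists c => // v; apply: le_trans (hnorm_sumr (T (0, v))) _.
    apply: le_trans (hT _) _; rewrite ler_wpM2l//.
    by rewrite /hnorm /dot_norm /= /sum_dot /= linear0r add0r.
  - move=> S cS; have := cT _ (sum_commutant (commutant_0 M1) cS).
    move=> cTS; apply/funext => v; have /(congr1 (@^~ (0, v))) := cTS.
    by rewrite /op_sum /= => /(congr1 snd).
exists (a1, a2) => //; apply/funext => -[v1 v2].
rewrite /sum_rep /op_sum /= a1E a2E /T1 /T2.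
have -> : (v1, v2) = (v1, 0) + (0, v2) :> H.
  by rewrite -[RHS]/(v1 + 0, 0 + v2) addr0 add0r.
rewrite TD; have := T1E v1; have := T2E v2.
case: (T (v1, 0)) => x1 x2; case: (T (0, v2)) => y1 y2 /= -> ->.
by rewrite -[RHS]/(x1 + 0, 0 + y2) addr0 add0r.
Qed.

Lemma sum_rep_vna : von_neumann_algebra (range sum_rep).
Proof.
split; last exact: sum_bicommutant.
move=> _ [a _ <-]; exists (sum_rep (sum_star a)); last exact: sum_rep_star.
by exists (sum_star a).
Qed.

Definition vn_sum : vnAlg R :=
  @VnAlg R A sum_star H sum_rep sum_rep_linear sum_rep_one
    sum_rep_mul sum_rep_star sum_rep_inj sum_rep_vna.

Lemma vn_le_sum (a b : vn_sum) :
  vn_le a b <-> vn_le (a.1 : M1) b.1 /\ vn_le (a.2 : M2) b.2.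
Proof.
split=> [h|[h1 h2] v]; last exact: addr_ge0 (h1 v.1) (h2 v.2).
split=> v.
  have := h (v, 0); rewrite /= /sum_dot /= [X in _ + X]linear0r addr0.
  exact.
have := h (0, v); rewrite /= /sum_dot /= [X in X + _]linear0r add0r.
exact.
Qed.

End VnSum.

Section TracialSum.
Variables (R : realType) (M1 M2 : tracialVnAlg R) (q : rat).
Hypothesis q01 : 0 < q < 1.
Local Notation C := R[i].
Local Notation M := (vn_sum M1 M2).

Definition sum_tau (a : M) : C :=
  ratr q * tau (a.1 : M1) + (1 - ratr q) * tau (a.2 : M2).

Let q_gt0 : 0 < ratr q :> C.
Proof. by rewrite ltr0q; case/andP: q01. Qed.

Let q1_gt0 : 0 < 1 - ratr q :> C.
Proof. by rewrite subr_gt0 -[X in _ < X](rmorph1 (ratr : rat -> C)) ltr_rat; case/andP: q01. Qed.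

Lemma sum_tau_linear (c : C) (a b : M) :
  sum_tau (c *: a + b) = c * sum_tau a + sum_tau b.
Proof.
rewrite /sum_tau /= !tau_linear !mulrDr.
by rewrite !(mulrCA c) addrACA.
Qed.

Lemma sum_tau_one : sum_tau 1 = 1.
Proof. by rewrite /sum_tau /= !tau_one !mulr1 addrC subrK. Qed.

Lemma sum_tau_pos (a : M) : vn_le 0 a -> 0 <= sum_tau a.
Proof.
move=> /vn_le_sum[a1 a2]; apply: addr_ge0; apply: mulr_ge0.
- exact: ltW.
- exact: tau_pos a1.
- exact: ltW.
- exact: tau_pos a2.
Qed.

Lemma sum_tau_faithful (a : M) : sum_tau (vn_star a * a) = 0 -> a = 0.
Proof.
case: a => a1 a2 /eqP; rewrite /sum_tau /=.
have a1ge0 := tau_sq_ge0 a1; have a2ge0 := tau_sq_ge0 a2.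
rewrite paddr_eq0 ?(mulr_ge0 (ltW q_gt0))// ?(mulr_ge0 (ltW q1_gt0))//.
rewrite (mulf_eq0 (ratr q : C)) (mulf_eq0 (1 - ratr q : C)).
rewrite (gt_eqF q_gt0) (gt_eqF q1_gt0) /=.
by move=> /andP[/eqP/tau_faithful -> /eqP/tau_faithful ->].
Qed.

Lemma sum_tau_trace (a b : M) : sum_tau (a * b) = sum_tau (b * a).
Proof. by rewrite /sum_tau /= !(tau_trace a.1) !(tau_trace a.2). Qed.

Lemma sum_tau_normal : normal sum_tau.
Proof.
move=> D s [D0 dD] saD [ubD lubD].
have fstD (a b : M) : D a -> D b -> exists c : M,
    [/\ D c, vn_le (a.1 : M1) c.1, vn_le (b.1 : M1) c.1,
        vn_le (a.2 : M2) c.2 & vn_le (b.2 : M2) c.2].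
  move=> Da Db; have [c [Dc /vn_le_sum[? ?] /vn_le_sum[? ?]]] := dD _ _ Da Db.
  by exists c.
have ub1 (a : M) : D a -> vn_le (a.1 : M1) s.1 by move=> /ubD/vn_le_sum[].
have ub2 (a : M) : D a -> vn_le (a.2 : M2) s.2 by move=> /ubD/vn_le_sum[].
pose D1 : set M1 := [set a.1 | a in D]; pose D2 : set M2 := [set a.2 | a in D].
have n1 := @tau_normal R M1 D1 s.1; have n2 := @tau_normal R M2 D2 s.2.
have {}n1 : (forall a, D a -> tau (a.1 : M1) <= tau (s.1 : M1)) /\
    (forall c, (forall a, D a -> tau (a.1 : M1) <= c) -> tau (s.1 : M1) <= c).
  have [|||n1a n1b] := n1.
  - split=> [|_ _ [a Da <-] [b Db <-]].
      by case: D0 => a Da; exists a.1; exists a.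
    by have [c [Dc ? ? _ _]] := fstD _ _ Da Db; exists c.1; split=> //; exists c.
  - by move=> _ [a Da <-]; rewrite -[in RHS](saD _ Da).
  - split=> [_ [a Da <-]|b hb]; first exact: ub1.
    have /lubD/vn_le_sum[]// : forall a, D a -> vn_le a ((b, s.2) : M).
    move=> a Da; apply/vn_le_sum; split; last exact: ub2.
    by apply: hb; exists a.
  split=> [a Da|c hc]; first by apply: n1a; exists a.
  by apply: n1b => _ [a Da <-]; exact: hc.
have {}n2 : (forall a, D a -> tau (a.2 : M2) <= tau (s.2 : M2)) /\
    (forall c, (forall a, D a -> tau (a.2 : M2) <= c) -> tau (s.2 : M2) <= c).
  have [|||n2a n2b] := n2.
  - split=> [|_ _ [a Da <-] [b Db <-]].
      by case: D0 => a Da; exists a.2; exists a.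
    by have [c [Dc _ _ ? ?]] := fstD _ _ Da Db; exists c.2; split=> //; exists c.
  - by move=> _ [a Da <-]; rewrite -[in RHS](saD _ Da).
  - split=> [_ [a Da <-]|b hb]; first exact: ub2.
    have /lubD/vn_le_sum[]// : forall a, D a -> vn_le a ((s.1, b) : M).
    move=> a Da; apply/vn_le_sum; split; first exact: ub1.
    by apply: hb; exists a.
  split=> [a Da|c hc]; first by apply: n2a; exists a.
  by apply: n2b => _ [a Da <-]; exact: hc.
split=> [a Da|c hc].
  apply: lerD.
    by rewrite (ler_pM2l q_gt0); exact: n1.1.
  by rewrite (ler_pM2l q1_gt0); exact: n2.1.
have tau_lec (a b : M) : D a -> D b ->
    ratr q * tau (a.1 : M1) + (1 - ratr q) * tau (b.2 : M2) <= c.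
  move=> Da Db; have [d [Dd da db]] := dD _ _ Da Db.
  have [{}da _] := (vn_le_sum _ _).1 da; have [_ {}db] := (vn_le_sum _ _).1 db.
  apply: le_trans (hc _ Dd).
  apply: lerD.
    by rewrite (ler_pM2l q_gt0); exact: tau_le.
  by rewrite (ler_pM2l q1_gt0); exact: tau_le.
have step (b : M) : D b ->
    ratr q * tau (s.1 : M1) + (1 - ratr q) * tau (b.2 : M2) <= c.
  move=> Db; rewrite -lerBrDr mulrC -ler_pdivlMr//; apply: n1.2 => a Da.
  by rewrite ler_pdivlMr// mulrC lerBrDr tau_lec.
rewrite -lerBrDl mulrC -ler_pdivlMr//; apply: n2.2 => b Db.
by rewrite ler_pdivlMr// mulrC lerBrDl step.
Qed.

Definition tracial_sum : tracialVnAlg R :=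
  @TracialVnAlg R M sum_tau sum_tau_linear sum_tau_one sum_tau_pos
    sum_tau_faithful sum_tau_trace sum_tau_normal.

End TracialSum.

(* Main.v *)
Require Import Defs.
From mathcomp Require Import all_boot all_order all_algebra.
From mathcomp Require Import all_classical all_reals all_analysis.
From mathcomp.real_closed Require Import complex.
From mathcomp Require Import cyclic separable cyclotomic ring.

(* A projection [e] of rank [a] in the [b x b] matrices is made constant on the
   diagonal by passing to left multiplication by [e] on the [b x b] matrices,
   written in the orthonormal basis of Weyl unitaries [u]: the diagonal entries
   are [tr (u^* e u) = a / b], and [b e] has entries in the ring of integers of a
   cyclotomic field. For microstates [X1], [X2] of the summands, the matrices
   [X1 (x) 1 (x) b e] and [1 (x) X2 (x) b (1 - e)], together with
   [1 (x) 1 (x) b e], are then microstates for [(b x1, 0)], [(0, b x2)] and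
   [(b, 0)], which generate the direct sum.

   In finite dimension, minimal projections [e_i] with sum 1 and matrix units
   between them are found by hand. The traces of the [e_i] are rational, since
   the trace of the central support of [e_i] is an integer multiple of it, so
   repeating each coordinate [i] proportionally to [tau e_i] gives a
   trace-preserving representation by matrices, in which matrix units are 0-1
   matrices. Composing with the same left multiplication makes every diagonal
   exactly constant, and [N] times a matrix unit has algebraic integer entries;
   the microstates can be taken constant in [k]. *)

Set Implicit Arguments.
Unset Strict Implicit.
Unset Printing Implicit Defensive.

Import Order.TTheory GRing.Theory Num.Theory.
Import numFieldNormedType.Exports.
Local Open Scope classical_set_scope.
Local Open Scope ring_scope.
Local Open Scope sesquilinear_scope.

(** * Galois conjugates of algebraic integers *)

Section GaloisConjugates.
Variable R : realType.
Local Notation C := R[i].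

Lemma algebraic_integer_Qbar (z : C) : algebraic_integer z -> Qbar z.
Proof.
move=> [p pm rp]; exists (map_poly intr p).
  by rewrite map_poly_eq0_id0 ?monic_neq0// (monicP pm) oner_eq0.
rewrite -map_poly_comp; congr (root _ z): rp.
by apply: eq_map_poly => x; rewrite /= ratr_int.
Qed.

Lemma algebraic_integer_int (m : int) : algebraic_integer (m%:~R : C).
Proof. exact: (integral_id (intr : {rmorphism int -> C})). Qed.

Lemma algebraic_integer_nat n : algebraic_integer (n%:R : C).
Proof. exact: (integral_nat (intr : {rmorphism int -> C})). Qed.

Lemma algebraic_integerM (x y : C) :
  algebraic_integer x -> algebraic_integer y -> algebraic_integer (x * y).
Proof. exact: (@integral_mul _ _ (intr : {rmorphism int -> C})). Qed.

Lemma algebraic_integer_sum (I : Type) (r : seq I) (P : pred I) (F : I -> C) :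
  (forall i, P i -> algebraic_integer (F i)) ->
  algebraic_integer (\sum_(i <- r | P i) F i).
Proof.
move=> h; apply: (big_ind (@algebraic_integer R)) => //.
  exact: (algebraic_integer_nat 0).
by move=> x y; exact: (@integral_add _ _ (intr : {rmorphism int -> C})).
Qed.

Lemma algebraic_integerX (z : C) n :
  algebraic_integer z -> algebraic_integer (z ^+ n).
Proof.
move=> hz; elim: n => [|n IH]; first exact: (algebraic_integer_nat 1).
by rewrite exprS; exact: algebraic_integerM.
Qed.

Lemma algebraic_integer_root_of_unity (z : C) n :
  z ^+ n.+1 = 1 -> algebraic_integer z.
Proof.
move=> zn; exists ('X^(n.+1) - 1); first by rewrite monic_Xn_sub_1.
by rewrite rmorphB /= map_polyXn rmorph1 rootE !hornerE zn subrr.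
Qed.

Lemma Qbar_ratr (x : rat) : Qbar (ratr x : C).
Proof. exact: (algebraic_id (ratr : {rmorphism rat -> C})). Qed.

Lemma Qbar0 : Qbar (0 : C).
Proof. by have := Qbar_ratr 0; rewrite rmorph0. Qed.

Lemma Qbar1 : Qbar (1 : C).
Proof. by have := Qbar_ratr 1; rewrite rmorph1. Qed.

Lemma QbarD (x y : C) : Qbar x -> Qbar y -> Qbar (x + y).
Proof. exact: (@algebraic_add _ _ (ratr : {rmorphism rat -> C})). Qed.

Lemma QbarM (x y : C) : Qbar x -> Qbar y -> Qbar (x * y).
Proof. exact: (@algebraic_mul _ _ (ratr : {rmorphism rat -> C})). Qed.

Section Automorphism.
Variable s : C -> C.
Hypothesis Gs : Gal s.

Lemma Gal0 : s 0 = 0.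
Proof.
case: Gs => _ sD _; have /eqP := sD 0 0 Qbar0 Qbar0.
by rewrite addr0 -subr_eq0 opprD addNKr oppr_eq0 => /eqP.
Qed.

(** [s 1] is idempotent, hence 0 or 1, and injectivity of [s] on [Qbar] excludes [s 1 = s 0]. *)
Lemma Gal1 : s 1 = 1.
Proof.
case: Gs => -[_ inj _] _ sM.
have /eqP := sM 1 1 Qbar1 Qbar1.
rewrite mulr1 -{1}[s 1]mulr1 -subr_eq0 -mulrBr mulf_eq0 => /orP[|].
  rewrite -Gal0 => /eqP/(inj _ _ (mem_set Qbar1) (mem_set Qbar0))/eqP.
  by rewrite oner_eq0.
by rewrite subr_eq0 => /eqP.
Qed.

Lemma GalM x y : Qbar x -> Qbar y -> s (x * y) = s x * s y.
Proof. by case: Gs => _ _; apply. Qed.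

Lemma GalD x y : Qbar x -> Qbar y -> s (x + y) = s x + s y.
Proof. by case: Gs => _ + _; apply. Qed.

Lemma Gal_nat n : s n%:R = n%:R.
Proof.
elim: n => [|n IH]; first exact: Gal0.
rewrite -!natr1 GalD ?IH ?Gal1//; last exact: Qbar1.
exact/algebraic_integer_Qbar/algebraic_integer_nat.
Qed.

Lemma Gal_int (m : int) : s m%:~R = m%:~R.
Proof.
have hi : Qbar (m%:~R : C) by exact/algebraic_integer_Qbar/algebraic_integer_int.
case: m hi => n hi; first exact: Gal_nat.
apply: (addIr n.+1%:R); rewrite -{1}[n.+1%:R]Gal_nat -GalD//.
  by rewrite NegzE rmorphN /= -pmulrn addNr Gal0.
exact/algebraic_integer_Qbar/algebraic_integer_nat.
Qed.

Lemma Gal_horner (p : {poly int}) z : Qbar z ->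
  s (map_poly intr p).[z] = (map_poly intr p).[s z].
Proof.
move=> hz.
(* The induction carries membership in [Qbar] along, since [s] is additive and multiplicative only
   there. *)
suff [] : Qbar (map_poly intr p).[z] /\
    s (map_poly intr p).[z] = (map_poly intr p).[s z] by [].
elim/poly_ind: p => [|p c [IH1 IH2]].
  by rewrite rmorph0 !horner0 Gal0; split=> //; exact: Qbar0.
rewrite rmorphD rmorphM /= map_polyX map_polyC /= !hornerE.
have hc : Qbar (c%:~R : C) by exact/algebraic_integer_Qbar/algebraic_integer_int.
split; first by apply: QbarD => //; exact: QbarM.
by rewrite GalD ?GalM ?IH2 ?Gal_int//; exact: QbarM.
Qed.

End Automorphism.

(** All conjugates of [z] are roots of the monic integer polynomial that annihilates [z]. *)
Lemma finite_conjugates (z : C) : algebraic_integer z ->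
  finite_set [set s z | s in @Gal R].
Proof.
move=> az; have hz := algebraic_integer_Qbar az.
case: az => p pm rp; set q := map_poly _ p in rp.
have [r qr] := closed_field_poly_normal q.
apply: (@sub_finite_set _ _ [set` r]); last exact: finite_seq.
move=> _ [s Gs <-] /=; rewrite -root_prod_XsubC.
have : root q (s z) by rewrite rootE -Gal_horner// (rootP rp) Gal0.
rewrite qr rootZ// lead_coef_eq0 map_poly_eq0_id0 ?monic_neq0//.
by rewrite (monicP pm) oner_eq0.
Qed.

(** The entries of every conjugate lie in the finite list [r] of the conjugates of all entries, and
    there are finitely many matrices over [r]. *)
Lemma finite_matrix_conjugates m n (A : 'M[C]_(m, n)) :
  (forall i j, algebraic_integer (A i j)) ->
  finite_set [set map_mx s A | s in @Gal R].
Proof.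
move=> hA; pose D i j := [set s (A i j) | s in @Gal R].
have fD i j : finite_set (D i j) by exact: finite_conjugates.
have /choice[f fE] : forall ij : 'I_m * 'I_n, exists l : seq C,
    D ij.1 ij.2 = [set` l] by move=> ij; exact/finite_seqP.
pose r := flatten [seq f ij | ij <- enum {: 'I_m * 'I_n}].
have hr s i j : Gal s -> s (A i j) \in r.
  move=> Gs; apply/flatten_mapP; exists (i, j); first by rewrite mem_enum.
  have : D i j (s (A i j)) by exists s.
  by rewrite (fE (i, j)).
apply: (@sub_finite_set _ _ ((fun g : {ffun 'I_m * 'I_n -> seq_sub r} =>
   \matrix_(i, j) val (g (i, j))) @` setT)).
  move=> _ [s Gs <-]; exists [ffun ij => SeqSub (hr s ij.1 ij.2 Gs)] => //.
  by apply/matrixP => i j; rewrite !mxE ffunE.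
by apply: finite_image; exact: finite_finset.
Qed.

End GaloisConjugates.

(** * Operator norm and Galois boundedness *)

Section CardinalBounds.

Lemma card_le_I_injP (T : Type) (A : set T) n :
  (A #<= `I_n)%card <->
  exists2 f : T -> nat, (forall x, A x -> (f x < n)%N) & {in A &, injective f}.
Proof.
split=> [/pcard_leP[f]|[f fn finj]].
  exists f => [x Ax|]; last exact: inj.
  by have := @funS _ _ _ _ f x Ax.
rewrite -(card_le_eql (inj_card_eq finj)).
by apply: subset_card_le => _ [x Ax <-]; exact: fn.
Qed.

(** Numberings [f] and [g] of the two sets combine in mixed radix: the pair [(x, y)] gets the number
    [f x * n + g y]. *)
Lemma card_le_I_setX (T U : Type) (A : set T) (B : set U) m n :
  (A #<= `I_m)%card -> (B #<= `I_n)%card -> (A `*` B #<= `I_(m * n))%card.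
Proof.
move=> /card_le_I_injP[f fm finj] /card_le_I_injP[g gn ginj].
apply/card_le_I_injP; exists (fun x => f x.1 * n + g x.2)%N.
  move=> [x y] [/= Ax By].
  have := fm x Ax; have := gn y By => gy fx.
  apply: (@leq_trans (f x * n + n)%N); first by rewrite ltn_add2l.
  by rewrite -mulSnr leq_mul2r fx orbT.
move=> [x y] [x' y'] /set_mem[/= Ax By] /set_mem[/= Ax' By'] e.
have n0 : (0 < n)%N by exact: leq_ltn_trans (gn _ By).
have eg : g y = g y'.
  by have := congr1 (modn^~ n) e; rewrite !modnMDl !modn_small// gn.
have ef : f x = f x'.
  by move: e; rewrite eg => /addIn/eqP; rewrite eqn_pmul2r// => /eqP.
by rewrite (finj _ _ (mem_set Ax) (mem_set Ax') ef)
  (ginj _ _ (mem_set By) (mem_set By') eg).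
Qed.

End CardinalBounds.

Section OperatorNorm.
Variable R : realType.
Local Notation C := R[i].
Local Notation normc := Normc.normc.

Lemma normc_ge0 (z : C) : 0 <= normc z.
Proof. by case: z => a b; exact: sqrtr_ge0. Qed.

Lemma normc_sum (I : Type) (r : seq I) (F : I -> C) :
  normc (\sum_(i <- r) F i) <= \sum_(i <- r) normc (F i).
Proof.
elim/big_rec2: _ => [|i y1 y2 _ h]; first by rewrite Normc.normc0.
by apply: le_trans (le_normcD _ _) _; rewrite lerD2l.
Qed.

Definition sqvnorm n (v : 'cV[C]_n) : R := \sum_i normc (v i 0) ^+ 2.

Lemma sqvnorm_ge0 n (v : 'cV[C]_n) : 0 <= sqvnorm v.
Proof. by apply: sumr_ge0 => i _; exact: sqr_ge0. Qed.

Lemma vnorm_le m n (u : 'cV[C]_m) (v : 'cV[C]_n) (c : R) : 0 <= c ->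
  (vnorm u <= c * vnorm v) = (sqvnorm u <= c ^+ 2 * sqvnorm v).
Proof.
move=> c0; rewrite -[c in LHS](@ger0_norm R)// -sqrtr_sqr -sqrtrM ?sqr_ge0//.
by rewrite ler_sqrt// mulr_ge0 ?sqr_ge0 ?sqvnorm_ge0.
Qed.

Lemma vnormZ n (c : C) (v : 'cV[C]_n) : vnorm (c *: v) = normc c * vnorm v.
Proof.
rewrite -[normc c](@ger0_norm R) ?normc_ge0// -sqrtr_sqr -sqrtrM ?sqr_ge0//.
congr Num.sqrt; rewrite mulr_sumr; apply: eq_bigr => i _.
by rewrite mxE Normc.normcM exprMn.
Qed.

Lemma normc_le_vnorm n (v : 'cV[C]_n) i : normc (v i 0) <= vnorm v.
Proof.
rewrite -[normc _](@ger0_norm R) ?normc_ge0// -sqrtr_sqr ler_sqrt ?sqvnorm_ge0//.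
by rewrite (bigD1 i)//= lerDl sumr_ge0// => j _; exact: sqr_ge0.
Qed.

Lemma vnorm_mulmx n (A : 'M[C]_n) (v : 'cV[C]_n) :
  vnorm (A *m v) <= opnorm A * vnorm v.
Proof.
have [v0|v0] := eqVneq (vnorm v) 0.
  have -> : v = 0.
    apply/matrixP => i j; rewrite ord1 mxE; apply: Normc.eq0_normc.
    by apply/eqP; rewrite eq_le normc_ge0 -v0 normc_le_vnorm.
  rewrite mulmx0 -[0 in leLHS](scale0r (0 : 'cV[C]_n)) vnormZ Normc.normc0 mul0r.
  rewrite -[0 in leRHS](scale0r (0 : 'cV[C]_n)) vnormZ Normc.normc0.
  by rewrite mul0r mulr0.
have vp : 0 < vnorm v by rewrite lt_neqAle eq_sym v0 sqrtr_ge0.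
have nc : normc (((vnorm v)^-1)%:C)%C = (vnorm v)^-1.
  by rewrite /normc /= expr0n /= addr0 sqrtr_sqr ger0_norm// invr_ge0 ltW.
rewrite -ler_pdivrMr// mulrC -nc -vnormZ scalemxAr.
apply: ub_le_sup; last first.
  by exists (((vnorm v)^-1)%:C%C *: v) => //=; rewrite vnormZ nc mulVf.
(* The set whose [sup] is [opnorm A] must be bounded above: if [vnorm u <= 1], each coordinate of
   [A *m u] is at most the sum of the moduli in its row of [A]. *)
exists (Num.sqrt (\sum_i (\sum_j normc (A i j)) ^+ 2)) => _ [u /= u1 <-].
rewrite ler_sqrt; last by apply: sumr_ge0 => i _; exact: sqr_ge0.
apply: ler_sum => i _; rewrite mxE ler_pXn2r// ?nnegrE ?normc_ge0//; last first.
  by apply: sumr_ge0 => j _; exact: normc_ge0.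
apply: le_trans (normc_sum _ _) _; apply: ler_sum => j _.
rewrite Normc.normcM ler_piMr ?normc_ge0//.
exact: le_trans (normc_le_vnorm _ _) u1.
Qed.

Lemma opnorm_le n (A : 'M[C]_n) (c : R) : 0 <= c ->
  (forall v, vnorm (A *m v) <= c * vnorm v) -> opnorm A <= c.
Proof.
move=> c0 h; apply: ge_sup => [|_ [u /= u1 <-]].
  exists (vnorm (A *m 0)); exists 0 => //=.
  by rewrite -[0 in leLHS](scale0r (0 : 'cV[C]_n)) vnormZ Normc.normc0 mul0r.
by apply: le_trans (h u) _; rewrite ler_piMr.
Qed.

(** A matrix of algebraic integers has finitely many conjugates, so a constant sequence is bounded
    in norm and in number of conjugates at once. *)
Lemma galois_bounded_cst (p : nat) (A : 'M[C]_p.+1) :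
  (forall i j, algebraic_integer (A i j)) ->
  galois_bounded (n := fun=> p) (fun=> A).
Proof.
move=> hA; have fA := finite_matrix_conjugates hA.
split=> //.
  have [l lE] : exists l : seq 'M[C]_p.+1, [set map_mx s A | s in @Gal R] = [set` l].
    exact/finite_seqP.
  exists (\sum_(B <- l) `|opnorm B|) => _ s Gs.
  have : map_mx s A \in l.
    have : [set map_mx s A | s in @Gal R] (map_mx s A) by exists s.
    by rewrite lE.
  elim: l {lE} => [//|B l IH]; rewrite inE big_cons => /orP[/eqP ->|/IH h].
    by apply: le_trans (ler_norm _) _; rewrite lerDl sumr_ge0.
  by apply: le_trans h _; rewrite lerDr.
by have /finite_set_leP[N hN] := fA; exists N.
Qed.

End OperatorNorm.

(** * Tensoring with a fixed matrix preserves Galois boundedness *)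

Section Amplification.
Variable R : realType.
Local Notation C := R[i].
Local Notation normc := Normc.normc.

(* [A (x) 1 (x) G], the rows and columns being indexed through [f]. *)
Definition amplify N n (K : finType) p (f : 'I_N -> 'I_n * K * 'I_p)
    (A : 'M[C]_n) (G : 'M[C]_p) : 'M[C]_N :=
  \matrix_(i, j) (((f i).1.2 == (f j).1.2)%:R *
                  (A (f i).1.1 (f j).1.1 * G (f i).2 (f j).2)).

(** Cauchy-Schwarz against the constant vector: expand the square and bound [y s * y t] by
    [(y s ^+ 2 + y t ^+ 2) / 2]. *)
Lemma sqr_sum_le (I : finType) (y : I -> R) :
  (\sum_t y t) ^+ 2 <= #|I|%:R * \sum_t y t ^+ 2.
Proof.
have -> : #|I|%:R * \sum_t y t ^+ 2 = \sum_s \sum_t (y s ^+ 2 + y t ^+ 2) / 2.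
  have e s : \sum_t (y s ^+ 2 + y t ^+ 2) / 2 =
      (y s ^+ 2 *+ #|I| + \sum_t y t ^+ 2) / 2.
    by rewrite -mulr_suml big_split /= sumr_const.
  rewrite (eq_bigr _ (fun s _ => e s)) -mulr_suml big_split /= sumr_const.
  by rewrite sumrMnl mulrDl -splitr mulr_natl.
rewrite expr2 mulr_suml; apply: ler_sum => s _.
rewrite mulr_sumr; apply: ler_sum => t _.
rewrite ler_pdivlMr// -subr_ge0.
have -> : y s ^+ 2 + y t ^+ 2 - y s * y t * 2 = (y s - y t) ^+ 2.
  by rewrite sqrrB mulr_natr addrAC.
exact: sqr_ge0.
Qed.

(** The estimate is crude but independent of [n] and [K], which is what a uniform bound along a
    sequence requires. A vector is cut into blocks of length [n], on which [A] acts, and the blocks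
    are recombined with the coefficients of [G]. *)
Lemma opnorm_amplify N n (K : finType) p (f : 'I_N -> 'I_n * K * 'I_p)
    (A : 'M[C]_n) (G : 'M[C]_p) (a g : R) : bijective f ->
  opnorm A <= a -> (forall s t, normc (G s t) <= g) -> 0 <= a -> 0 <= g ->
  opnorm (amplify f A G) <= p%:R * g * a.
Proof.
move=> [h fK hK] Aa Gg a0 g0.
have c0 : 0 <= p%:R * g * a by rewrite !mulr_ge0.
have fb : bijective f by exists h.
have hb : bijective h by exists f.
apply: opnorm_le => // v; rewrite vnorm_le// /sqvnorm.
(* [w k t] is the block of [v] with second index [k] and third index [t]. *)
pose w k t : 'cV[C]_n := \col_x v (h (x, k, t)) 0.
have reidx (F : 'I_N -> R) :
    \sum_i F i = \sum_k \sum_t \sum_x F (h (x, k, t)).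
  rewrite (reindex h) /=; last exact: onW_bij.
  rewrite (eq_bigr (fun y => F (h (y.1.1, y.1.2, y.2)))) => [|[[]]//].
  rewrite -(pair_bigA _ (fun y t => F (h (y.1, y.2, t)))) /=.
  rewrite -(pair_bigA _ (fun x k => \sum_t F (h (x, k, t)))) /= exchange_big /=.
  by apply: eq_bigr => k _; exact: exchange_big.
have vE : \sum_i normc (v i 0) ^+ 2 = \sum_k \sum_t sqvnorm (w k t).
  rewrite reidx; apply: eq_bigr => k _; apply: eq_bigr => t _.
  by apply: eq_bigr => x _; rewrite mxE.
have avE x k s : (amplify f A G *m v) (h (x, k, s)) 0 =
    \sum_t G s t * (A *m w k t) x 0.
  rewrite mxE (reindex h) /=; last exact: onW_bij.
  rewrite (eq_bigr (fun y => ((k == y.1.2)%:R * (A x y.1.1 * G s y.2)) *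
    v (h (y.1.1, y.1.2, y.2)) 0)); last first.
    by move=> [[x' k'] t] _; rewrite mxE !hK.
  rewrite -(pair_bigA _ (fun y t => ((k == y.2)%:R * (A x y.1 * G s t)) *
    v (h (y.1, y.2, t)) 0)) /= exchange_big /=.
  apply: eq_bigr => t _.
  rewrite -(pair_bigA _ (fun x' k' => ((k == k')%:R * (A x x' * G s t)) *
    v (h (x', k', t)) 0)) /=.
  rewrite mxE mulr_sumr; apply: eq_bigr => x' _.
  rewrite (bigD1 k)//= big1 ?addr0 => [|k' /negbTE kk'].
    by rewrite eqxx mul1r mxE mulrCA mulrA.
  by rewrite eq_sym kk' !mul0r.
rewrite vE reidx mulr_sumr; apply: ler_sum => k _.
(* The bound for one [s] does not depend on [s]; summing over the [p] values of [s] yields the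
   factor [(p * g * a) ^+ 2]. *)
apply: (@le_trans _ _ (\sum_(s < p) g ^+ 2 * p%:R * (a ^+ 2 * \sum_t sqvnorm (w k t)))).
  apply: ler_sum => s _; rewrite -mulrA mulr_sumr.
  have -> : g ^+ 2 * (p%:R * \sum_t a ^+ 2 * sqvnorm (w k t)) =
      \sum_t g ^+ 2 * (p%:R * (a ^+ 2 * sqvnorm (w k t))).
    by rewrite !mulr_sumr.
  apply: (@le_trans _ _ (\sum_(t < p) g ^+ 2 * (p%:R * sqvnorm (A *m w k t)))).
    rewrite -!mulr_sumr exchange_big /= !mulr_sumr; apply: ler_sum => x _.
    rewrite avE; apply: (@le_trans _ _ ((\sum_t g * normc ((A *m w k t) x 0)) ^+ 2)).
      rewrite ler_pXn2r ?nnegrE ?normc_ge0//; last first.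
        by apply: sumr_ge0 => t _; rewrite mulr_ge0 ?normc_ge0.
      apply: le_trans (normc_sum _ _) _; apply: ler_sum => t _.
      by rewrite Normc.normcM ler_wpM2r ?normc_ge0.
    rewrite -mulr_sumr exprMn ler_wpM2l ?sqr_ge0//.
    by have := sqr_sum_le (fun t => normc ((A *m w k t) x 0)); rewrite card_ord.
  apply: ler_sum => t _; rewrite ler_wpM2l ?sqr_ge0// ler_wpM2l//.
  rewrite -vnorm_le//; apply: le_trans (vnorm_mulmx _ _) _.
  by rewrite ler_wpM2r// sqrtr_ge0.
rewrite sumr_const card_ord -[leLHS]mulr_natl.

have -> : (p%:R * g * a) ^+ 2 = p%:R * (g ^+ 2 * p%:R) * a ^+ 2.
  by rewrite !exprMn [p%:R ^+ 2]expr2 -(mulrA p%:R) [p%:R * g ^+ 2]mulrC.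
by rewrite !mulrA lexx.
Qed.

(** Conjugation acts on the two tensor factors separately, so a conjugate of the amplification is
    determined by a conjugate of [X k] and one of [G]. As [G] and [p] are fixed along the sequence,
    the norm bounds and the counts multiply. *)
Lemma galois_bounded_amplify (N n : nat -> nat) (K : nat -> finType) p
    (f : forall k, 'I_(N k).+1 -> 'I_(n k).+1 * K k * 'I_p)
    (X : forall k, 'M[C]_((n k).+1)) (G : 'M[C]_p) :
  (forall k, bijective (f k)) -> galois_bounded X ->
  (forall s t, algebraic_integer (G s t)) ->
  galois_bounded (fun k => amplify (f k) (X k) G).
Proof.
move=> fb [Xi [B XB] [m Xm]] Gi; have fG := finite_matrix_conjugates Gi.
have mapE k s : Gal s -> map_mx s (amplify (f k) (X k) G) =
    amplify (f k) (map_mx s (X k)) (map_mx s G).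
  move=> Gs; apply/matrixP => i j; rewrite !mxE.
  have [_|_] := eqVneq; last by rewrite !mul0r Gal0.
  by rewrite !mul1r GalM//; exact: algebraic_integer_Qbar.
split.
- move=> k i j; rewrite mxE; apply: algebraic_integerM.
    exact: algebraic_integer_nat.
  exact: algebraic_integerM.
- have [l lE] : exists l : seq 'M[C]_p, [set map_mx s G | s in @Gal R] = [set` l].
    exact/finite_seqP.
  (* The sum of the moduli of all entries of all conjugates of [G] bounds each of them, uniformly in
     [s]. *)
  pose g := \sum_(H <- l) \sum_s \sum_t normc (H s t).
  have g0 : 0 <= g.
    by do 3 (apply: sumr_ge0 => ? _); exact: normc_ge0.
  exists (p%:R * g * `|B|) => k s Gs; rewrite mapE//.
  apply: opnorm_amplify => //; first by apply: le_trans (XB k s Gs) (ler_norm _).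
  move=> i j; have : map_mx s G \in l.
    have : [set map_mx s G | s in @Gal R] (map_mx s G) by exists s.
    by rewrite lE.
  rewrite /g; elim: l {lE g g0} => [//|H l IH]; rewrite inE big_cons => /orP[/eqP ->|/IH h].
    rewrite (bigD1 i)//= (bigD1 j)//= -!addrA lerDl.
    by rewrite !addr_ge0//; do ?(apply: sumr_ge0 => ? _); exact: normc_ge0.
  apply: le_trans h _; rewrite lerDr.
  by do 2 (apply: sumr_ge0 => ? _); exact: normc_ge0.
- have /finite_set_leP[m' hm'] := fG; exists (m * m')%N => k.
  apply: card_le_trans (card_le_I_setX (Xm k) hm').
  apply: card_le_trans (card_image_le (fun x => amplify (f k) x.1 x.2) _).
  apply: subset_card_le => _ [s Gs <-]; exists (map_mx s (X k), map_mx s G) => /=.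
    by split; exists s.
  by rewrite mapE.
Qed.

End Amplification.

(** * Star-polynomials and roots of unity *)

Section StarPolynomials.
Variable K : fieldType.

Definition star_hom (A B : algType K) (sA : A -> A) (sB : B -> B)
    (phi : A -> B) : Prop :=
  [/\ linear phi, forall a b, phi (a * b) = phi a * phi b, phi 1 = 1 &
      forall a, phi (sA a) = sB (phi a)].

Lemma starpoly_eval_hom (A B : algType K) (sA : A -> A) (sB : B -> B)
    (phi : A -> B) (I : Type) (x : I -> A) (P : starpoly K I) :
  star_hom sA sB phi ->
  phi (starpoly_eval sA x P) = starpoly_eval sB (phi \o x) P.
Proof.
move=> [phiL phiM phi1 phiS].
have phi0 : phi 0 = 0.
  have := phiL 1 0 0; rewrite scale1r addr0 scale1r => /eqP.
  by rewrite -subr_eq0 opprD addNKr oppr_eq0 => /eqP.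
rewrite /starpoly_eval; elim: P => [|[c w] P IH]; first by rewrite !big_nil.
rewrite !big_cons phiL IH /=; congr (_ *: _ + _).
elim: w => [|[i b] w IHw]; first by rewrite !big_nil.
by rewrite !big_cons phiM IHw /=; case: b; rewrite ?phiS.
Qed.

Lemma starpoly_eval_pair (A B : algType K) (sA : A -> A) (sB : B -> B)
    (I : Type) (x : I -> A * B) (P : starpoly K I) :
  starpoly_eval (A := (A * B)%type) (fun a => (sA a.1, sB a.2)) x P =
  (starpoly_eval sA (fst \o x) P, starpoly_eval sB (snd \o x) P).
Proof.
rewrite [LHS]surjective_pairing; congr pair.
  exact: (@starpoly_eval_hom (A * B)%type A _ sA fst).
exact: (@starpoly_eval_hom (A * B)%type B _ sB snd).
Qed.

Lemma eq_starpoly_eval (A : algType K) (s : A -> A) (I : Type) (x y : I -> A)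
  (P : starpoly K I) : x =1 y -> starpoly_eval s x P = starpoly_eval s y P.
Proof. by move=> /funext ->. Qed.

(* The variable [i] is replaced by the scalar [(m i).1] times the variable     *)
(* [(m i).2], or times 1 when [(m i).2] is [None].                             *)
Section MonomialSubstitution.
Variables (conj : K -> K) (I J : Type) (m : I -> K * option J).

Definition subst_word (w : seq (I * bool)) : K * seq (J * bool) :=
  foldr (fun l acc =>
    ((if l.2 then conj (m l.1).1 else (m l.1).1) * acc.1,
     oapp (fun j => (j, l.2) :: acc.2) acc.2 (m l.1).2)) (1, [::]) w.

Definition subst_starpoly (P : starpoly K I) : starpoly K J :=
  [seq (t.1 * (subst_word t.2).1, (subst_word t.2).2) | t <- P].

(** Polynomials in rescaled generators become polynomials in the original ones, for which
    microstates are at hand. *)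
Lemma eval_subst_starpoly (A : algType K) (s : A -> A) (x : J -> A) P :
  s 1 = 1 -> (forall c a, s (c *: a) = conj c *: s a) ->
  starpoly_eval s (fun i => (m i).1 *: oapp x 1 (m i).2) P =
  starpoly_eval s x (subst_starpoly P).
Proof.
move=> s1 sZ; rewrite /starpoly_eval big_map; apply: eq_bigr => -[c w] _ /=.
rewrite -scalerA; congr (_ *: _).
elim: w => [|[i b] w IH] /=; first by rewrite !big_nil scale1r.
rewrite big_cons IH /= -scalerA.
case: (m i) => d [j|] /=; rewrite ?big_cons; case: b => /=;
  by rewrite ?sZ ?s1 -scalerAl ?mul1r -?scalerAr.
Qed.

End MonomialSubstitution.
End StarPolynomials.

(** * Roots of unity and indexing of matrices by finite types *)

Section RootsOfUnity.
Variable R : realType.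
Local Notation C := R[i].

(** In characteristic 0 the polynomial ['X^(n.+1) - 1] is separable, so it has [n.+1] distinct
    roots, among which [has_prim_root] finds a primitive one. *)
Lemma primitive_root_exists n : exists w : C, (n.+1).-primitive_root w.
Proof.
pose p : {poly C} := 'X^(n.+1) - 1; have [r Dp] := closed_field_poly_normal p.
rewrite (monicP _) ?monicXnsubC // scale1r in Dp.
have rn1 : all (n.+1).-unity_root r.
  by apply/allP => z; rewrite -root_prod_XsubC -Dp.
have sz_r : (n.+1 < (size r).+1)%N.
  by rewrite -(size_prod_XsubC r id) -Dp size_XnsubC.
have [|z] := hasP (has_prim_root (ltn0Sn n) rn1 _ sz_r); last by exists z.
by rewrite -separable_prod_XsubC -Dp separable_Xn_sub_1 // pnatr_eq0.
Qed.

Lemma sum_root_of_unity (z : C) n : z ^+ n.+1 = 1 ->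
  \sum_(a < n.+1) z ^+ a = (z == 1)%:R * n.+1%:R.
Proof.
move=> zn; have [->|z1] := eqVneq.
  by rewrite mul1r (eq_bigr (fun=> 1)) ?sumr_const ?card_ord// => a _; rewrite expr1n.
have : (z - 1) * \sum_(a < n.+1) z ^+ a = 0 by rewrite -subrX1 zn subrr.
by move/eqP; rewrite mulf_eq0 subr_eq0 (negbTE z1) /= mul0r => /eqP.
Qed.

End RootsOfUnity.

(** Matrices are indexed by ordinals, while the constructions below use products and disjoint unions
    as index sets; [t0] makes the size positive. *)
Lemma ord_bijection (T : finType) (t0 : T) :
  exists N (f : 'I_N.+1 -> T), bijective f.
Proof.
have e : #|T| = #|T|.-1.+1 by rewrite prednK//; apply/card_gt0P; exists t0.
exists #|T|.-1, (fun i => enum_val (cast_ord (esym e) i)).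
exists (fun t => cast_ord e (enum_rank t)) => [i|t].
  by rewrite enum_valK cast_ordKV.
by rewrite cast_ordK enum_rankK.
Qed.

(** * The constant diagonal embedding *)

Section ConstantDiagonal.
Variable R : realType.
Local Notation C := R[i].

Lemma adjmxM m n p (A : 'M[C]_(m, n)) (B : 'M[C]_(n, p)) :
  (A *m B)^t* = B^t* *m A^t*.
Proof. by rewrite trmx_mul map_mxM. Qed.

Lemma adjmxK m n (A : 'M[C]_(m, n)) : A^t*^t* = A.
Proof. by apply/matrixP => i j; rewrite !mxE conjCK. Qed.

Lemma adjmxZ m n (c : C) (A : 'M[C]_(m, n)) : (c *: A)^t* = c^* *: A^t*.
Proof. by apply/matrixP => i j; rewrite !mxE rmorphM. Qed.

Lemma adjmx_sum m n (I : Type) (r : seq I) (F : I -> 'M[C]_(m, n)) :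
  (\sum_(i <- r) F i)^t* = \sum_(i <- r) (F i)^t*.
Proof.
apply/matrixP => i j; rewrite !mxE !summxE rmorph_sum.
by apply: eq_bigr => k _; rewrite !mxE.
Qed.

Lemma conj_root_of_unity (w : C) n : w ^+ n.+1 = 1 -> w^* = w^-1.
Proof.
move=> wn; have w1 : `|w| = 1.
  by apply/eqP; rewrite -(@pexpr_eq1 _ _ n.+1)// -normrX wn normr1.
by rewrite invC_norm w1 expr1n invr1 mul1r.
Qed.

(* The matrix of left multiplication by [X] on 'M_n in the orthonormal basis    *)
(* of Weyl unitaries [u_(a,b)], whose entry (i, j) is [w ^ (a i)] if [j = i + b] *)
(* and 0 otherwise: its diagonal entries are the numbers tr (u^* X u) = tr X.    *)
Lemma constant_diagonal_embedding n : exists p (Psi : 'M[C]_(n.+1) -> 'M[C]_(p.+1)),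
  [/\ star_hom (fun A : 'M[C]_(n.+1) => A^t*) (fun A : 'M[C]_(p.+1) => A^t*) Psi,
      forall (A : 'M[C]_(n.+1)) i, Psi A i i = ntr A &
      forall A : 'M[C]_(n.+1), (forall i j, algebraic_integer (A i j)) ->
        forall i j, algebraic_integer (n.+1%:R * Psi A i j)].
Proof.
have [w wP] := primitive_root_exists R n; have wn := prim_expr_order wP.
have cw := conj_root_of_unity wn.
have cwn : w^* ^+ n.+1 = 1 by rewrite -rmorphXn wn rmorph1.
have w0 : w != 0 by apply: contra_eq_neq wn => ->; rewrite expr0n eq_sym oner_eq0.
have [p [f [h fK hK]]] := ord_bijection ((0, 0) : 'I_n.+1 * 'I_n.+1).
have reidx (F : 'I_n.+1 -> 'I_n.+1 -> C) :
    \sum_i F (f i).1 (f i).2 = \sum_b \sum_a F a b.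
  rewrite (reindex h) /=; last by apply: onW_bij; exists f.
  under eq_bigr do rewrite hK.
  by rewrite -(pair_bigA _ F) exchange_big.
(* Orthogonality of the characters of the cyclic group: [w ^+ k * w^* ^+ l] equals 1 only for
   [k = l], as [w] is primitive. *)
have sumw (k l : 'I_n.+1) : \sum_(a < n.+1) (w ^+ k * w^* ^+ l) ^+ a =
    (k == l)%:R * n.+1%:R.
  have wkl : (w ^+ k * w^* ^+ l) ^+ n.+1 = 1.
    by rewrite exprMn -!exprM ![(_ * n.+1)%N]mulnC !exprM wn cwn !expr1n mulr1.
  rewrite sum_root_of_unity//; congr (_%:R * _); congr nat_of_bool.
  rewrite cw exprVn -[X in _ == X](@divff _ (w ^+ l)) ?expf_neq0//.
  rewrite (inj_eq (mulIf _)) ?invr_eq0 ?expf_neq0//.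
  by rewrite (eq_prim_root_expr wP) !modn_small.
have n0 : n.+1%:R != 0 :> C by rewrite pnatr_eq0.
(* Up to a constant, [W j] expresses the matrix units of column [j] in the Weyl basis. Left
   multiplication by [A] preserves columns, so its matrix in that basis is a multiple of the sum of
   the [W j *m A *m (W j)^t*]. The sum [i + (f s).2] is taken modulo [n.+1]. *)
pose W (j : 'I_n.+1) : 'M[C]_(p.+1, n.+1) :=
  \matrix_(s, i) ((i + (f s).2 == j)%:R * w^* ^+ ((f s).1 * i)).
(* Orthogonality relations of the Weyl basis; they make [Psi] multiplicative. *)
have WW j j' : (W j)^t* *m W j' = ((j == j')%:R * n.+1%:R)%:M.
  apply/matrixP => k l; rewrite !mxE.
  pose F (a b : 'I_n.+1) : C := (k + b == j)%:R * (l + b == j')%:R *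
    (w ^+ k * w^* ^+ l) ^+ a.
  have -> : \sum_s (W j)^t* k s * W j' s l = \sum_s F (f s).1 (f s).2.
    apply: eq_bigr => s _; rewrite !mxE rmorphM rmorph_nat rmorphXn /= conjCK.
    by rewrite /F mulrACA exprMn -!exprM ![(_ * (f s).1)%N]mulnC.
  rewrite reidx /F; under eq_bigr do rewrite -mulr_sumr sumw.
  have [<-|] := eqVneq k l; last first.
    by move=> _; rewrite big1 ?mulr0n// => b _; rewrite mul0r mulr0.
  rewrite mul1r mulr1n -mulr_suml; congr (_ * _).
  have jk : k + (j - k) = j by rewrite addrC subrK.
  rewrite (bigD1 (j - k))//= jk eqxx mul1r big1 ?addr0// => b.
  by have [<-|_ _] := eqVneq (k + b) j; [rewrite addrC addrA addNr add0r eqxx|rewrite mul0r].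
(* Completeness of the basis; it makes [Psi] unital. *)
have WW1 : \sum_j W j *m (W j)^t* = n.+1%:R%:M.
  apply/matrixP => s t; rewrite summxE.
  have -> : \sum_j (W j *m (W j)^t*) s t = \sum_j \sum_i
      (i + (f s).2 == j)%:R * (i + (f t).2 == j)%:R *
      (w ^+ (f t).1 * w^* ^+ (f s).1) ^+ i.
    apply: eq_bigr => j _; rewrite mxE; apply: eq_bigr => i _.
    rewrite !mxE rmorphM rmorph_nat rmorphXn /= conjCK mulrACA.
    by rewrite exprMn -!exprM [w^* ^+ _ * _]mulrC.
  rewrite exchange_big /=.
  under eq_bigr => i _ do rewrite -mulr_suml.
  have e i : \sum_j (i + (f s).2 == j)%:R * (i + (f t).2 == j)%:R =
      ((f s).2 == (f t).2)%:R :> C.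
    rewrite (bigD1 (i + (f s).2))//= eqxx mul1r big1 ?addr0 => [|j].
      by rewrite (inj_eq (addrI _)) eq_sym.
    by rewrite eq_sym => /negbTE ->; rewrite mul0r.
  under eq_bigr => i _ do rewrite e.
  rewrite -mulr_sumr sumw mxE -(bij_eq (f := f)); last by exists h.
  case: (f s) (f t) => a b [a' b'] /=; rewrite mulrA -natrM mulnb.
  by rewrite xpair_eqE andbC [a' == a]eq_sym; case: andP; rewrite ?mul1r ?mul0r.
pose Psi (A : 'M[C]_(n.+1)) : 'M[C]_(p.+1) :=
  n.+1%:R^-1 *: \sum_j W j *m A *m (W j)^t*.
exists p, Psi; split; first split.
- move=> c A B; rewrite /Psi scalerA mulrC -scalerA -scalerDr; congr (_ *: _).
  rewrite scaler_sumr -big_split /=; apply: eq_bigr => j _.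
  by rewrite mulmxDr mulmxDl scalemxAl scalemxAr.
- move=> A B; rewrite /Psi -scalerAl -scalerAr scalerA.
  have -> : (\sum_j W j *m A *m (W j)^t*) * (\sum_j W j *m B *m (W j)^t*) =
      \sum_j n.+1%:R *: (W j *m (A * B) *m (W j)^t*).
    rewrite mulr_suml; apply: eq_bigr => j _; rewrite mulr_sumr.
    have e j' : (W j *m A *m (W j)^t*) * (W j' *m B *m (W j')^t*) =
       ((j == j')%:R * n.+1%:R) *: (W j *m (A * B) *m (W j')^t*).
      rewrite -[LHS]/(_ *m _) !mulmxA -(mulmxA (W j *m A)) WW.
      by rewrite mul_mx_scalar -!scalemxAl -mulmxA.
    rewrite (bigD1 j)//= e eqxx mul1r big1 ?addr0// => j' jj'.
    by rewrite e eq_sym (negbTE jj') mul0r scale0r.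
  by rewrite -scaler_sumr scalerA -mulrA mulVf// mulr1.
- rewrite /Psi; under eq_bigr do rewrite mulmx1.
  by rewrite WW1 scale_scalar_mx mulVf.
- move=> A; rewrite /Psi adjmxZ fmorphV rmorph_nat adjmx_sum; congr (_ *: _).
  by apply: eq_bigr => j _; rewrite !adjmxM adjmxK mulmxA.
- move=> A s; rewrite /Psi mxE summxE /ntr mulrC; congr (_ / _).
  have -> : \sum_j (W j *m A *m (W j)^t*) s s = \sum_j \sum_i \sum_k
      (i + (f s).2 == j)%:R * ((k + (f s).2 == j)%:R *
      (w^* ^+ ((f s).1 * i) * w ^+ ((f s).1 * k) * A i k)).
    apply: eq_bigr => j _; rewrite mxE exchange_big; apply: eq_bigr => k _ /=.
    rewrite mxE mulr_suml; apply: eq_bigr => i _; rewrite !mxE.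
    rewrite rmorphM rmorph_nat rmorphXn /= conjCK.
    by ring.
  (* On the diagonal the two indicators force [k = i], and then the powers of [w] and [w^*]
     cancel. *)
  rewrite exchange_big /mxtrace; apply: eq_bigr => i _ /=.
  rewrite (bigD1 (i + (f s).2))//= [X in _ + X]big1 ?addr0 => [|j]; last first.
    by rewrite eq_sym => /negbTE h1; rewrite big1// => k _; rewrite h1 mul0r.
  rewrite (bigD1 i)//= big1 ?addr0 => [|k /negbTE ki]; last first.
    by rewrite eqxx mul1r (inj_eq (addIr _)) ki mul0r.
  by rewrite !eqxx !mul1r -exprMn cw mulVf// expr1n mul1r.
(* The factor [n.+1] cancels the normalization of [Psi]; what remains is a sum of products of
   entries of [A] and powers of roots of unity. *)
- move=> A Ai s t; rewrite /Psi mxE mulrA divff// mul1r summxE.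
  have aw : algebraic_integer w by exact: algebraic_integer_root_of_unity wn.
  have acw : algebraic_integer w^* by exact: algebraic_integer_root_of_unity cwn.
  have aW j i k : algebraic_integer (W j i k).
    rewrite mxE; apply: algebraic_integerM; first exact: algebraic_integer_nat.
    exact: algebraic_integerX.
  have acW j i k : algebraic_integer ((W j)^t* i k).
    rewrite !mxE rmorphM rmorph_nat rmorphXn /= conjCK.
    apply: algebraic_integerM; first exact: algebraic_integer_nat.
    exact: algebraic_integerX.
  apply: algebraic_integer_sum => j _; rewrite mxE.
  apply: algebraic_integer_sum => k _; apply: algebraic_integerM => //.
  rewrite mxE; apply: algebraic_integer_sum => l _; exact: algebraic_integerM.
Qed.
End ConstantDiagonal.

(** * Generators of von Neumann algebras *)

Section VonNeumannAlgebras.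
Variables (R : realType) (H : hilbert R) (N : set (H -> H)).
Local Notation C := R[i].
Hypothesis vN : von_neumann_algebra N.

Lemma vna_memP T : N T <->
  bounded_op T /\ forall S, commutant N S -> T \o S = S \o T.
Proof. by case: vN => _ e; rewrite -[in N T]e. Qed.

Lemma vna_bounded T : N T -> bounded_op T.
Proof. by move=> /vna_memP[]. Qed.

Lemma vna_commute S T : commutant N S -> N T -> T \o S = S \o T.
Proof. by move=> cS /vna_memP[_ /(_ S cS)]. Qed.

Lemma bounded_op_comp (T S : H -> H) :
  bounded_op T -> bounded_op S -> bounded_op (T \o S).
Proof.
move=> [lT [c c0 hT]] [lS [d d0 hS]]; split.
  by move=> a u v; rewrite /= lS lT.
exists (c * d); first exact: mulr_ge0.
move=> v; apply: le_trans (hT _) _; rewrite -mulrA.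
by rewrite ler_wpM2l.
Qed.

Lemma hnormZ (c : C) (v : H) : hnorm (c *: v) = `|c| * hnorm v.
Proof.
rewrite /hnorm /dot_norm linearZl_LR /= linearZr_LR /=.
rewrite mulrA -normCK rootCMl ?exprn_ge0//.
by rewrite sqrCK.
Qed.

(** The parallelogram law gives the triangle inequality up to a factor 2, which suffices for the
    boundedness of sums of operators. *)
Lemma hnormD_le (u v : H) : hnorm (u + v) <= 2 * (hnorm u + hnorm v).
Proof.
rewrite -(@ler_pXn2r _ 2)// ?nnegrE ?mulr_ge0 ?addr_ge0 ?sqrt_dnorm_ge0// sqrtCK.
set a := hnorm u; set b := hnorm v.
have a0 : 0 <= a by exact: sqrt_dnorm_ge0.
have b0 : 0 <= b by exact: sqrt_dnorm_ge0.
have : hdot H (u + v) (u + v) <= 2 * (a ^+ 2 + b ^+ 2).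
  rewrite !sqrtCK -[leLHS]addr0.
  apply: (@le_trans _ _ (hdot H (u + v) (u + v) + hdot H (u - v) (u - v))).
    by rewrite lerD2l dnorm_ge0.
  by rewrite dnormD dnormB addrACA subrr addr0 mulr_natl mulr2n.
move/le_trans; apply.
have -> : (2 * (a + b)) ^+ 2 =
    2 * (a ^+ 2 + b ^+ 2) + (2 * (a ^+ 2 + b ^+ 2) + 8 * (a * b)) by ring.
by rewrite lerDl addr_ge0 ?mulr_ge0 ?addr_ge0 ?exprn_ge0.
Qed.

Lemma vna_id : N (fun v => v).
Proof. by apply/vna_memP; split=> //; exact: bounded_op_id. Qed.

Lemma vna_comp T S : N T -> N S -> N (T \o S).
Proof.
move=> NT NS; apply/vna_memP; split=> [|U cU].
  by apply: bounded_op_comp; exact: vna_bounded.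
by rewrite -compA (vna_commute cU NS) compA (vna_commute cU NT) -compA.
Qed.

Lemma vna_linear (c : C) T S : N T -> N S -> N (fun v => c *: T v + S v).
Proof.
move=> NT NS; have [lT [a a0 hT]] := vna_bounded NT.
have [lS [b b0 hS]] := vna_bounded NS.
apply/vna_memP; split=> [|U cU].
  split=> [d u v|].
    by rewrite lT lS !scalerDr !scalerA (mulrC c) addrACA.
  exists (2 * (`|c| * a + b)); first by rewrite mulr_ge0// addr_ge0// mulr_ge0.
  move=> v; apply: le_trans (hnormD_le _ _) _.
  rewrite -mulrA ler_wpM2l// mulrDl lerD// hnormZ -mulrA.
  by rewrite ler_wpM2l.
have [[lU _] _] := cU; apply/funext => v /=; rewrite lU.
by have /(congr1 (@^~ v)) /= -> := vna_commute cU NT;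
   have /(congr1 (@^~ v)) /= -> := vna_commute cU NS.
Qed.

Lemma vna_0 : N (fun=> 0).
Proof.
have := vna_linear (-1) vna_id vna_id; congr N.
by apply/funext => v; rewrite scaleN1r addNr.
Qed.

End VonNeumannAlgebras.

Section Corner.
Variables (R : realType) (H1 H : hilbert R).
Variables (emb : H1 -> H) (proj : H -> H1).
Hypotheses (embL : linear emb) (projL : linear proj).
Hypothesis embK : cancel emb proj.
Hypothesis adj : forall u w, hdot H (emb u) w = hdot H1 u (proj w).
Hypothesis hnorm_emb : forall u, hnorm (emb u) = hnorm u.
Hypothesis hnorm_proj : forall w, hnorm (proj w) <= hnorm w.

(** With [p] the projection [emb \o proj], this is the corner [p N p] seen on [H1]. An element of
    the commutant of [N] commutes with [p], so its compression to [H1] lies in the commutant of the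
    corner. Hence if [A] is in the bicommutant of the corner, [emb \o A \o proj] commutes with the
    commutant of [N]. *)
Lemma corner_vna (N : set (H -> H)) : von_neumann_algebra N ->
  N (emb \o proj) -> von_neumann_algebra [set T : H1 -> H1 | N (emb \o T \o proj)].
Proof.
move=> vN Np; split.
  move=> T /= NT; have [S NS aS] := vN.1 _ NT.
  exists (proj \o S \o emb) => [/=|u v /=].
    by have := vna_comp vN Np (vna_comp vN NS Np).
  by rewrite -adj -aS /= embK adj embK.
apply/seteqP; split=> [A [bA cA]|A /= NA]; last first.
  split=> [|S [_ cS]]; last by rewrite cS.
  have [lA [c c0 hA]] := vna_bounded vN NA; split.
    move=> a u v; have := lA a (emb u) (emb v).
    by rewrite -embL /= !embK -embL => /(can_inj embK).
  by exists c => // v; have := hA (emb v); rewrite /= embK !hnorm_emb.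
have [lA [c c0 hA]] := bA; apply/(vna_memP vN); split.
  split; first by move=> a u v; rewrite /= projL lA embL.
  exists c => // v; rewrite /= hnorm_emb; apply: le_trans (hA _) _.
  by rewrite ler_wpM2l.
move=> T cT; have [[lT [d d0 hT]] _] := cT.
have Tp w : T (emb (proj w)) = emb (proj (T w)).
  by have /(congr1 (@^~ w)) := vna_commute vN cT Np.
have cT1 : commutant [set T : H1 -> H1 | N (emb \o T \o proj)] (proj \o T \o emb).
  split; first split.
  - by move=> a u v; rewrite /= embL lT projL.
  - exists d => // v; apply: le_trans (hnorm_proj _) _.
    by rewrite -(hnorm_emb v).
  - move=> S NS; apply/funext => v /=.
    have /(congr1 (@^~ (emb v))) /= := vna_commute vN cT NS.
    by rewrite embK => <-; rewrite embK.
apply/funext => v /=.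
have /(congr1 (@^~ (proj v))) /= := cA _ cT1.
by rewrite Tp embK => ->; rewrite -Tp embK.
Qed.

End Corner.

Section Generators.
Variable R : realType.
Local Notation C := R[i].

Lemma spanning_generates (M : vnAlg R) (I : finType) (x : I -> M) :
  (forall a : M, exists c : I -> C, a = \sum_i c i *: x i) -> generates x.
Proof.
move=> hx N vN Nx _ [a _ <-]; have [c ->] := hx a.
have vnL (c' : C) (a' b' : M) : vn_rep (c' *: a' + b') =
    (fun v => c' *: vn_rep a' v + vn_rep b' v).
  by apply/funext => v; rewrite vn_rep_linear.
elim/big_rec: _ => [|i y _ Ny].
  have := vna_0 vN; congr N; by apply/funext => v; rewrite vn_rep0.
by rewrite vnL; exact: vna_linear.
Qed.

Section DirectSum.
Variables (M1 M2 : vnAlg R) (I1 I2 : Type) (x1 : I1 -> M1) (x2 : I2 -> M2).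
Local Notation H1 := (vn_space M1).
Local Notation H2 := (vn_space M2).

(** The generator [b *: (1, 0)] puts both coordinate projections into [N]. The two corners of [N]
    are then von Neumann algebras that contain the generators of the summands, hence all of [M1] and
    [M2]. *)
Lemma generates_sum (I : Type) (x : I -> vn_sum M1 M2) (b : C) : b != 0 ->
  generates x1 -> generates x2 ->
  (exists i, x i = b *: ((1, 0) : vn_sum M1 M2)) ->
  (forall j, exists i, x i = b *: ((x1 j, 0) : vn_sum M1 M2)) ->
  (forall j, exists i, x i = b *: ((0, x2 j) : vn_sum M1 M2)) ->
  generates x.
Proof.
move=> b0 g1 g2 [i0 xi0] hx1 hx2 N vN Nx.
have Nscale (a : vn_sum M1 M2) i : x i = b *: a -> N (vn_rep a).
  move=> xi; have := vna_linear vN b^-1 (Nx i) (vna_0 vN).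
  congr N; apply/funext => v.
  rewrite addr0 xi -[in LHS](addr0 (b *: a)) vn_rep_linear vn_rep0 addr0.
  by rewrite scalerA mulVf// scale1r.
pose e1 (u : H1) : vn_space (vn_sum M1 M2) := (u, 0).
pose p1 (w : vn_space (vn_sum M1 M2)) : H1 := w.1.
pose e2 (u : H2) : vn_space (vn_sum M1 M2) := (0, u).
pose p2 (w : vn_space (vn_sum M1 M2)) : H2 := w.2.
have rep1 (a : M1) : vn_rep ((a, 0) : vn_sum M1 M2) = e1 \o vn_rep a \o p1.
  by apply/funext => v; rewrite /= /sum_rep /op_sum /= vn_rep0.
have rep2 (a : M2) : vn_rep ((0, a) : vn_sum M1 M2) = e2 \o vn_rep a \o p2.
  by apply/funext => v; rewrite /= /sum_rep /op_sum /= vn_rep0.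
have N1 : N (e1 \o p1).
  have := Nscale _ _ xi0; rewrite rep1; congr N.
  by apply/funext => v; rewrite /= vn_rep_one.
have N2 : N (e2 \o p2).
  (* The second coordinate projection is the identity minus the first. *)
  have := vna_linear vN (-1) N1 (vna_id vN); congr N.
  apply/funext => -[u v]; rewrite scaleN1r.
  by rewrite -[LHS]/(- u + u, - 0 + v) addNr oppr0 add0r.
have vN1 : von_neumann_algebra [set T : H1 -> H1 | N (e1 \o T \o p1)].
  apply: corner_vna vN N1 => //.
  - by move=> a u v; rewrite -[RHS]/(a *: u + v, a *: 0 + 0) scaler0 addr0.
  - by move=> u w; rewrite /= /sum_dot /= linear0l addr0.
  - by move=> u; rewrite /hnorm /dot_norm /= /sum_dot /= linear0r addr0.
  - by move=> w; exact: hnorm_suml.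
have vN2 : von_neumann_algebra [set T : H2 -> H2 | N (e2 \o T \o p2)].
  apply: corner_vna vN N2 => //.
  - by move=> a u v; rewrite -[RHS]/(a *: 0 + 0, a *: u + v) scaler0 addr0.
  - by move=> u w; rewrite /= /sum_dot /= linear0l add0r.
  - by move=> u; rewrite /hnorm /dot_norm /= /sum_dot /= linear0r add0r.
  - by move=> w; exact: hnorm_sumr.
have M1N (a : M1) : N (e1 \o vn_rep a \o p1).
  apply: (g1 _ vN1) => [j|]; last by exists a.
  by have [i xi] := hx1 j; rewrite /= -rep1; exact: Nscale xi.
have M2N (a : M2) : N (e2 \o vn_rep a \o p2).
  apply: (g2 _ vN2) => [j|]; last by exists a.
  by have [i xi] := hx2 j; rewrite /= -rep2; exact: Nscale xi.
move=> _ [[a1 a2] _ <-].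
have := vna_linear vN 1 (M1N a1) (M2N a2); congr N.
apply/funext => v; rewrite scale1r.
by rewrite -[LHS]/(vn_rep a1 v.1 + 0, 0 + vn_rep a2 v.2) addr0 add0r.
Qed.

End DirectSum.
End Generators.

(** * Direct sums *)

Section AmplificationAlgebra.
Variable R : realType.
Local Notation C := R[i].
Variables (N n : nat) (K : finType) (p : nat) (f : 'I_N -> 'I_n * K * 'I_p).
Hypothesis f_bij : bijective f.

Lemma sum_bijection3 (F : 'I_n -> K -> 'I_p -> C) :
  \sum_i F (f i).1.1 (f i).1.2 (f i).2 = \sum_x \sum_k \sum_t F x k t.
Proof.
rewrite pair_bigA pair_bigA /= [RHS](reindex f)//=.
exact: onW_bij.
Qed.

Lemma amplify_linear (G : 'M[C]_p) : linear (fun A => amplify f A G).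
Proof.
by move=> c A B; apply/matrixP => i j; rewrite !mxE; ring.
Qed.

Lemma amplifyDr (A : 'M[C]_n) (G G' : 'M[C]_p) :
  amplify f A (G + G') = amplify f A G + amplify f A G'.
Proof. by apply/matrixP => i j; rewrite !mxE; ring. Qed.

Lemma amplify_adj (A : 'M[C]_n) (G : 'M[C]_p) :
  (amplify f A G)^t* = amplify f (A^t*) (G^t*).
Proof.
by apply/matrixP => i j; rewrite !mxE !rmorphM rmorph_nat eq_sym.
Qed.

Lemma amplifyM (A B : 'M[C]_n) (G G' : 'M[C]_p) :
  amplify f A G *m amplify f B G' = amplify f (A *m B) (G *m G').
Proof.
apply/matrixP => i j; rewrite !mxE.
pose F x k t := ((f i).1.2 == k)%:R * (k == (f j).1.2)%:R *
  ((A (f i).1.1 x * B x (f j).1.1) * (G (f i).2 t * G' t (f j).2)).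
rewrite (eq_bigr (fun l => F (f l).1.1 (f l).1.2 (f l).2)); last first.
  by move=> l _; rewrite !mxE /F; ring.
rewrite sum_bijection3 mulr_suml mulr_sumr; apply: eq_bigr => x _.
rewrite (bigD1 (f i).1.2)//= [X in _ + X]big1 ?addr0 => [|k]; last first.
  rewrite eq_sym => /negbTE h; rewrite big1// => t _.
  by rewrite /F h !mul0r.
rewrite !mulr_sumr; apply: eq_bigr => t _.
by rewrite /F eqxx mul1r.
Qed.

(** Each [x] occurs [#|K| * p] times among the [(f i).1.1], so both sides are the same average. *)
Lemma mean_bijection (g : 'I_n -> C) : (0 < n)%N -> (0 < N)%N ->
  (\sum_i g (f i).1.1) / N%:R = (\sum_x g x) / n%:R.
Proof.
move=> n0 N0; have NE : N = (n * (#|K| * p))%N.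
  by have := bij_eq_card f_bij; rewrite !card_prod !card_ord mulnA.
have m0 : (#|K| * p)%:R != 0 :> C.
  by rewrite pnatr_eq0; apply: contraTneq N0 => m0; rewrite NE m0 muln0.
rewrite (sum_bijection3 (fun x _ _ => g x)).
have e x : \sum_(k : K) \sum_(t < p) g x = g x *+ (#|K| * p).
  by rewrite sumr_const sumr_const card_ord -mulrnA mulnC.
rewrite (eq_bigr _ (fun x _ => e x)) sumrMnl NE natrM -[_ *+ _]mulr_natr.
by rewrite -mulf_div divff// mulr1.
Qed.

End AmplificationAlgebra.

(** * Mixing two matrices along a projection with constant diagonal *)

Section Mixing.
Variable R : realType.
Local Notation C := R[i].

Lemma constant_diagonal_projection (q : rat) : 0 < q < 1 ->
  exists p b (e : 'M[C]_p.+1),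
    [/\ e * e = e, e^t* = e, forall i, e i i = ratr q,
      forall i j, algebraic_integer (b.+1%:R * e i j) &
      forall i j, algebraic_integer (b.+1%:R * (1 - e) i j)].
Proof.
move=> /andP[q0 q1].
(* Lowest terms: [b] is the predecessor of the denominator of [q], and [a <= b.+1] makes [D] below a
   projection of rank [a]. *)
have [a [b [ab qE]]] : exists a b : nat, (a <= b.+1)%N /\ q = a%:R / b.+1%:R.
  exists `|numq q|%N, `|denq q|.-1%N; rewrite prednK ?absz_gt0 ?denq_neq0//.
  have qE : q = `|numq q|%:R / `|denq q|%:R.
    by rewrite -[LHS]divq_num_den !natr_absz !gtr0_norm// numq_gt0.
  split=> //; move: q1; rewrite {1}qE ltr_pdivrMr ?ltr0n ?absz_gt0 ?denq_neq0//.
  by rewrite mul1r ltr_nat => /ltnW.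
have [p [Psi [[PL PM P1 PS] Pd Pi]]] := constant_diagonal_embedding R b.
pose d : 'rV[C]_(b.+1) := \row_i (i < a)%:R.
pose D : 'M[C]_(b.+1) := diag_mx d.
have PB : Psi (1 - D) = 1 - Psi D.
  by have := PL (-1) D 1; rewrite P1 !scaleN1r => h; rewrite [1 - D]addrC h addrC.
have D_int i j : algebraic_integer (D i j).
  by rewrite !mxE -mulrnA; exact: algebraic_integer_nat.
exists p, b, (Psi D); split.
- rewrite -PM; congr Psi; rewrite -[LHS]/(D *m D) mulmx_diag; congr diag_mx.
  by apply/rowP => i; rewrite !mxE -natrM mulnb andbb.
- rewrite -PS; congr Psi; rewrite tr_diag_mx map_diag_mx; congr diag_mx.
  by apply/rowP => i; rewrite !mxE rmorph_nat.
- move=> i; rewrite Pd /ntr mxtrace_diag qE fmorph_div !rmorph_nat; congr (_ / _).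
  under eq_bigr do rewrite mxE.
  have -> : \sum_(i < b.+1) (i < a)%:R = \sum_(i < b.+1 | (i < a)%N) 1 :> C.
    by rewrite [RHS]big_mkcond; apply: eq_bigr => i' _; case: ifP.
  by rewrite -(big_ord_widen _ (fun=> 1))// sumr_const card_ord.
- exact: Pi.
(* [1 - D] is again a 0-1 matrix. *)
- rewrite -PB; apply: Pi => i j; rewrite !mxE -mulrnA.
  have -> : (i == j)%:R - (((i < a) * (i == j))%N)%:R = ((a <= i)%N && (i == j))%:R :> C.
    by rewrite [(a <= i)%N]leqNgt mulnb; case: (i < a)%N; case: eqP => _ /=; rewrite ?subrr ?subr0.
  exact: algebraic_integer_nat.
Qed.

End Mixing.

Section Mix.
Variable R : realType.
Local Notation C := R[i].
Variables (N n1 n2 p : nat).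
Variable f : 'I_N.+1 -> 'I_n1.+1 * 'I_n2.+1 * 'I_p.+1.
Hypothesis f_bij : bijective f.
Variable e : 'M[C]_(p.+1).
Hypotheses (eE : e * e = e) (eS : e^t* = e).
Local Notation A := ('M[C]_(n1.+1) * 'M[C]_(n2.+1))%type.

(** With the first two factors exchanged, [amplify] produces [1 (x) Y (x) G] on the same index
    set. *)
Definition swap_index i : 'I_n2.+1 * 'I_n1.+1 * 'I_p.+1 :=
  ((f i).1.2, (f i).1.1, (f i).2).

Lemma swap_index_bij : bijective swap_index.
Proof.
case: f_bij => h fK hK; exists (fun t => h (t.1.2, t.1.1, t.2)).
  by move=> i; rewrite /swap_index /=; case: (f i) (fK i) => [[]].
by move=> [[x y] t]; rewrite /swap_index /= hK.
Qed.

(* [X.1 (x) 1 (x) e + 1 (x) X.2 (x) (1 - e)] *)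
Definition mix (X : A) : 'M[C]_(N.+1) :=
  amplify f X.1 e + amplify swap_index X.2 (1 - e).

(** In either order the product is [X (x) Y (x) (G * G')]. *)
Lemma amplify_mul_swap (X : 'M[C]_(n1.+1)) (Y : 'M[C]_(n2.+1))
    (G G' : 'M[C]_(p.+1)) : G * G' = 0 ->
  amplify f X G *m amplify swap_index Y G' = 0 /\
  amplify swap_index Y G *m amplify f X G' = 0.
Proof.
move=> GG; split; apply/matrixP => i j; rewrite !mxE.
  pose F (x : 'I_n1.+1) (y : 'I_n2.+1) t :=
    ((f i).1.2 == y)%:R * (x == (f j).1.1)%:R *
    (X (f i).1.1 x * Y y (f j).1.2) * (G (f i).2 t * G' t (f j).2).
  rewrite (eq_bigr (fun l => F (f l).1.1 (f l).1.2 (f l).2)); last first.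
    by move=> l _; rewrite !mxE /F /=; ring.
  rewrite (sum_bijection3 f_bij) big1// => x _; rewrite big1// => y _.
  have /matrixP/(_ (f i).2 (f j).2) := GG.
  by rewrite -mulr_sumr !mxE => ->; rewrite mulr0.
pose F (x : 'I_n1.+1) (y : 'I_n2.+1) t :=
  ((f i).1.1 == x)%:R * (y == (f j).1.2)%:R *
  (X x (f j).1.1 * Y (f i).1.2 y) * (G (f i).2 t * G' t (f j).2).
rewrite (eq_bigr (fun l => F (f l).1.1 (f l).1.2 (f l).2)); last first.
  by move=> l _; rewrite !mxE /F /=; ring.
rewrite (sum_bijection3 f_bij) big1// => x _; rewrite big1// => y _.
have /matrixP/(_ (f i).2 (f j).2) := GG.
by rewrite -mulr_sumr !mxE => ->; rewrite mulr0.
Qed.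

(** [e] and [1 - e] are orthogonal projections with sum 1, so [mix] is the sum of two homomorphisms
    with orthogonal ranges. *)
Lemma mix_star_hom :
  star_hom (A := A) (fun X => (X.1^t*, X.2^t*)) (fun X => X^t*) mix.
Proof.
have e1 : e * (1 - e) = 0 by rewrite mulrBr mulr1 eE subrr.
have e2 : (1 - e) * e = 0 by rewrite mulrBl mul1r eE subrr.
have e3 : (1 - e) * (1 - e) = 1 - e by rewrite mulrBr mulr1 e2 subr0.
split.
- move=> c X Y; rewrite /mix /= (amplify_linear f e c X.1 Y.1).
  rewrite (amplify_linear swap_index (1 - e) c X.2 Y.2).
  by rewrite scalerDr addrACA.
- move=> X Y; rewrite /mix -[RHS]/(_ *m _) mulmxDl !mulmxDr.
  rewrite (amplifyM f_bij) (amplifyM swap_index_bij).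
  have [-> _] := amplify_mul_swap X.1 Y.2 e1.
  have [_ ->] := amplify_mul_swap Y.1 X.2 e2.
  by rewrite addr0 add0r -[e *m e]/(e * e) eE -[_ *m (1 - e)]/(_ * _) e3.
- rewrite /mix /=.
  have -> : amplify swap_index (1 : 'M[C]_(n2.+1)) (1 - e) =
      amplify f (1 : 'M[C]_(n1.+1)) (1 - e).
    by apply/matrixP => i j; rewrite !mxE; ring.
  rewrite -amplifyDr addrC subrK.
  apply/matrixP => i j; rewrite !mxE -(bij_eq f_bij).
  case: (f i) (f j) => [[x y] t] [[x' y'] t'] /=.
  rewrite !xpair_eqE -!natrM !mulnb; congr (nat_of_bool _)%:R.
  by rewrite andbA [(y == y') && _]andbC.
- move=> X; rewrite /mix /=.
  have -> (B D : 'M[C]_(N.+1)) : (B + D)^t* = B^t* + D^t*.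
    by apply/matrixP => i j; rewrite !mxE rmorphD.
  rewrite !amplify_adj eS; congr (_ + amplify _ _ _).
  apply/matrixP => i j; rewrite !mxE rmorphB rmorph_nat eq_sym.
  by have /matrixP/(_ i j) := eS; rewrite !mxE => h; rewrite /= h.
Qed.

Variable q : C.
Hypothesis e_diag : forall i, e i i = q.

Lemma mix_diag (X : A) i :
  mix X i i = q * X.1 (f i).1.1 (f i).1.1 + (1 - q) * X.2 (f i).1.2 (f i).1.2.
Proof. by rewrite !mxE !eqxx e_diag /=; ring. Qed.

Lemma ntr_mix (X : A) : ntr (mix X) = q * ntr X.1 + (1 - q) * ntr X.2.
Proof.
rewrite /ntr /mxtrace.
rewrite -(mean_bijection f_bij (fun x => X.1 x x))//.
rewrite -(mean_bijection swap_index_bij (fun x => X.2 x x))//.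
rewrite !mulrA -mulrDl !mulr_sumr -big_split /=; congr (_ / _).
by apply: eq_bigr => i _; exact: mix_diag.
Qed.

Lemma norm2_ge0 n (Y : 'M[C]_(n.+1)) : 0 <= norm2 Y.
Proof.
rewrite sqrtC_ge0 divr_ge0// /mxtrace sumr_ge0// => i _.
by rewrite mxE sumr_ge0// => j _; rewrite !mxE mulrC -normCK exprn_ge0.
Qed.

Lemma norm2_diag_part n (Y : 'M[C]_(n.+1)) c :
  norm2 (diag_part Y - c%:M) ^+ 2 = (\sum_i `|Y i i - c| ^+ 2) / n.+1%:R.
Proof.
rewrite sqrtCK /ntr; congr (_ / _); apply: eq_bigr => i _.
rewrite mxE (bigD1 i)//= !mxE eqxx !mulr1n mulrC -normCK big1 ?addr0//.
by move=> j /negbTE ji; rewrite !mxE ji !mulr0n subr0 mulr0.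
Qed.

(** Each diagonal deviation of the mix is [q * u + (1 - q) * v], where [u] and [v] are deviations of
    the components. The square is at most [2 * (|u|^2 + |v|^2)], and averaging over the index set
    gives the norms. *)
Lemma norm2_mix (X : A) : `|q| <= 1 -> `|1 - q| <= 1 ->
  norm2 (diag_part (mix X) - (ntr (mix X))%:M) <=
  2 * (norm2 (diag_part X.1 - (ntr X.1)%:M) +
       norm2 (diag_part X.2 - (ntr X.2)%:M)).
Proof.
move=> q1 q2.
have a0 := norm2_ge0 (diag_part X.1 - (ntr X.1)%:M).
have b0 := norm2_ge0 (diag_part X.2 - (ntr X.2)%:M).
rewrite -(@ler_pXn2r _ 2)// ?nnegrE ?norm2_ge0 ?mulr_ge0 ?addr_ge0//.
set a := norm2 _ in a0 *; set b := norm2 _ in b0 *.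
apply: (@le_trans _ _ (2 * (a ^+ 2 + b ^+ 2))); last first.
  have -> : (2 * (a + b)) ^+ 2 =
    2 * (a ^+ 2 + b ^+ 2) + (2 * (a ^+ 2 + b ^+ 2) + 8 * (a * b)) by ring.
  by rewrite lerDl addr_ge0 ?mulr_ge0 ?addr_ge0 ?exprn_ge0.
rewrite !norm2_diag_part.
rewrite -(mean_bijection f_bij (fun x => `|X.1 x x - ntr X.1| ^+ 2))//.
rewrite -(mean_bijection swap_index_bij (fun x => `|X.2 x x - ntr X.2| ^+ 2))//.
rewrite -mulrDl mulrA ler_wpM2r// -big_split mulr_sumr /=.
apply: ler_sum => i _; rewrite mix_diag ntr_mix.
set u := X.1 _ _ - _; set v := X.2 _ _ - _.
have -> : q * X.1 (f i).1.1 (f i).1.1 + (1 - q) * X.2 (f i).1.2 (f i).1.2 -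
    (q * ntr X.1 + (1 - q) * ntr X.2) = q * u + (1 - q) * v.
  by rewrite /u /v; ring.
apply: (@le_trans _ _ ((`|u| + `|v|) ^+ 2)).
  rewrite ler_pXn2r ?nnegrE ?addr_ge0//.
  by apply: le_trans (ler_normD _ _) _; rewrite !normrM lerD// ler_piMl.
rewrite -subr_ge0.
have -> : 2 * (`|u| ^+ 2 + `|v| ^+ 2) - (`|u| + `|v|) ^+ 2 = (`|u| - `|v|) ^+ 2.
  by ring.
by rewrite real_exprn_even_ge0// rpredB// normr_real.
Qed.

End Mix.

(** * The involution of a von Neumann algebra *)

Section StarFacts.
Variables (R : realType) (M : vnAlg R).
Local Notation C := R[i].

(** Adjoints are unique because the form is definite; the algebraic laws of [vn_star] below are all
    instances. *)
Lemma vn_star_unique (a b : M) :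
  adjoint_op (vn_rep a) (vn_rep b) -> b = vn_star a.
Proof.
move=> ab; apply: vn_rep_inj; apply/funext => v; apply/eqP.
rewrite -subr_eq0 -(dnorm_eq0 (hdot (vn_space M))) linearBr /=.
by rewrite -ab -(vn_rep_star a) subrr.
Qed.

Lemma vn_star_linear (c : C) (a b : M) :
  vn_star (c *: a + b) = c^* *: vn_star a + vn_star b.
Proof.
apply/esym/vn_star_unique => u v; rewrite !vn_rep_linear.
by rewrite linearPl linearPr /= conjCK !(vn_rep_star _ u).
Qed.

Lemma vn_star0 : vn_star (0 : M) = 0.
Proof.
by apply/esym/vn_star_unique => u v; rewrite !vn_rep0 linear0l linear0r.
Qed.

Lemma vn_star1 : vn_star (1 : M) = 1.
Proof. by apply/esym/vn_star_unique => u v; rewrite !vn_rep_one. Qed.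

Lemma vn_starZ (c : C) (a : M) : vn_star (c *: a) = c^* *: vn_star a.
Proof. by rewrite -[c *: a]addr0 vn_star_linear vn_star0 addr0. Qed.

Lemma vn_starD (a b : M) : vn_star (a + b) = vn_star a + vn_star b.
Proof. by rewrite -[a]scale1r vn_star_linear rmorph1 !scale1r. Qed.

Lemma vn_starB (a b : M) : vn_star (a - b) = vn_star a - vn_star b.
Proof. by rewrite vn_starD -scaleN1r vn_starZ rmorphN1 scaleN1r. Qed.

Lemma vn_star_sum (I : Type) (r : seq I) (F : I -> M) :
  vn_star (\sum_(i <- r) F i) = \sum_(i <- r) vn_star (F i).
Proof. by apply: (big_morph (@vn_star R M)); [exact: vn_starD|exact: vn_star0]. Qed.

Lemma vn_starM (a b : M) : vn_star (a * b) = vn_star b * vn_star a.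
Proof.
by apply/esym/vn_star_unique => u v; rewrite !vn_rep_mul !(vn_rep_star _ _).
Qed.

Lemma vn_starK (a : M) : vn_star (vn_star a) = a.
Proof.
apply/esym/vn_star_unique => u v; rewrite (hermC (hdot _)) /= mul1r.
by rewrite -vn_rep_star [RHS](hermC (hdot _)) /= mul1r.
Qed.

End StarFacts.

Section DirectSum.
Variable R : realType.
Local Notation C := R[i].

(** Here the size varies with [k], so [galois_bounded_cst] does not apply; the identity is its only
    conjugate and has norm at most 1. *)
Lemma galois_bounded1 (n : nat -> nat) :
  galois_bounded (fun k => 1 : 'M[C]_((n k).+1)).
Proof.
have s1 k s : Gal s -> map_mx s (1 : 'M[C]_((n k).+1)) = 1.
  move=> Gs; apply/matrixP => i j; rewrite !mxE.
  by case: (i == j); rewrite ?Gal1 ?Gal0.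
split.
- by move=> k i j; rewrite mxE; exact: algebraic_integer_nat.
- exists 1 => k s Gs; rewrite s1//; apply: opnorm_le => // v.
  by rewrite mul1mx mul1r.
- exists 1%N => k; apply: (@card_le_trans _ _ _ [set (1 : 'M[C]_((n k).+1))]).
    by apply: subset_card_le => _ [s Gs <-] /=; exact: s1.
  by rewrite (card_le_eql card_set1).
Qed.

Lemma amplifyZ N n (K : finType) p (f : 'I_N -> 'I_n * K * 'I_p) (c : C)
  (A : 'M[C]_n) (G : 'M[C]_p) : amplify f (c *: A) G = amplify f A (c *: G).
Proof. by apply/matrixP => i j; rewrite !mxE; ring. Qed.

Lemma amplify0 N n (K : finType) p (f : 'I_N -> 'I_n * K * 'I_p)
  (A : 'M[C]_n) : amplify f A 0 = 0.
Proof. by apply/matrixP => i j; rewrite !mxE; ring. Qed.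

Lemma tends_to_le (u v : nat -> C) :
  (forall k, 0 <= u k <= v k) -> tends_to v 0 -> tends_to u 0.
Proof.
move=> uv /cvgr0Pnorm_lt v0; apply/cvgr0Pnorm_lt => e e0.
have := v0 e e0; apply: filterS => k; apply: le_lt_trans.
have /andP[u0 h] := uv k.
by rewrite !ger0_norm// (le_trans u0 h).
Qed.

Lemma algebraically_sofic_sum (M1 M2 : tracialVnAlg R) (q : rat)
    (q01 : 0 < q < 1) :
  algebraically_sofic M1 -> algebraically_sofic M2 ->
  algebraically_sofic (tracial_sum M1 M2 q01).
Proof.
move=> [I1 [x1 [g1 s1]]] [I2 [x2 [g2 s2]]].
have [p [b [e [eE eS e_diag e_int e1_int]]]] := constant_diagonal_projection R q01.
pose B : C := b.+1%:R; have B0 : B != 0 by rewrite pnatr_eq0.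
(* [None] stands for the generator [(B, 0)], and [inl], [inr] for generators of the summands scaled
   by [B]. The pair [(0, None)] encodes a zero coordinate. The factor [B] makes the entries of the
   microstates integral. *)
pose m1 (i : option (I1 + I2)) : C * option I1 :=
  match i with
  | None => (B, None) | Some (inl j) => (B, Some j) | Some (inr _) => (0, None)
  end.
pose m2 (i : option (I1 + I2)) : C * option I2 :=
  match i with
  | None => (0, None) | Some (inl _) => (0, None) | Some (inr j) => (B, Some j)
  end.
pose y1 i : M1 := (m1 i).1 *: oapp x1 1 (m1 i).2.
pose y2 i : M2 := (m2 i).1 *: oapp x2 1 (m2 i).2.
exists (option (I1 + I2)), (fun i => (y1 i, y2 i)); split.
  apply: (@generates_sum _ M1 M2 _ _ x1 x2 _ _ B) => //.
  - by exists None; rewrite /y1 /y2 /= scale0r -[RHS]/(_, B *: 0) scaler0.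
  - by move=> j; exists (Some (inl j)); rewrite /y1 /y2 /= scale0r -[RHS]/(_, B *: 0) scaler0.
  - by move=> j; exists (Some (inr j)); rewrite /y1 /y2 /= scale0r -[RHS]/(B *: 0, _) scaler0.
move=> F finF.
pose F1 := (fun j => Some (inl j)) @^-1` F : set I1.
pose F2 := (fun j => Some (inr j)) @^-1` F : set I2.
have finF1 : finite_set F1 by apply: finite_preimage => // j j' _ _ [].
have finF2 : finite_set F2 by apply: finite_preimage => // j j' _ _ [].
have [n1 [X1 [X1gb X1ms X1ac]]] := s1 F1 finF1.
have [n2 [X2 [X2gb X2ms X2ac]]] := s2 F2 finF2.
(* [l1] is [m1] with its variables in the finite set [F1], over which the microstates [X1] are
   defined. *)
have /choice[l1 l1E] : forall i : F, exists r : C * option F1,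
    m1 (\val i) = (r.1, omap \val r.2).
  move=> [[[j|j]|] /set_mem Fi] /=; [|by exists (0, None)|by exists (B, None)].
  by exists (B, Some (exist _ j (mem_set Fi))).
have /choice[l2 l2E] : forall i : F, exists r : C * option F2,
    m2 (\val i) = (r.1, omap \val r.2).
  move=> [[[j|j]|] /set_mem Fi] /=; [by exists (0, None)| |by exists (0, None)].
  by exists (B, Some (exist _ j (mem_set Fi))).
have bij k := ord_bijection
  ((ord0, ord0, ord0) : 'I_(n1 k).+1 * 'I_(n2 k).+1 * 'I_p.+1).
pose N k := projT1 (cid (bij k)).
pose f k : 'I_(N k).+1 -> _ := projT1 (cid (projT2 (cid (bij k)))).
have fb k : bijective (f k) := projT2 (cid (projT2 (cid (bij k)))).
pose Z1 k (i : F) := (l1 i).1 *: oapp (X1 k) 1 (l1 i).2.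
pose Z2 k (i : F) := (l2 i).1 *: oapp (X2 k) 1 (l2 i).2.
pose P1 := subst_starpoly Num.conj l1; pose P2 := subst_starpoly Num.conj l2.
have starmx1 n : (1 : 'M[C]_(n.+1))^t* = 1.
  by apply/matrixP => i j; rewrite !mxE rmorph_nat eq_sym.
(* Since [mix] is a star homomorphism, a polynomial in the new microstates is the mix of polynomials
   in the old ones, to which [ntr_mix] and [norm2_mix] apply. *)
have eval_mix k P : mx_eval (fun i => mix (f k) e (Z1 k i, Z2 k i)) P =
    mix (f k) e (mx_eval (X1 k) (P1 P), mx_eval (X2 k) (P2 P)).
  rewrite -[LHS]/(starpoly_eval _ (mix (f k) e \o (fun i => (Z1 k i, Z2 k i))) P).
  rewrite -(starpoly_eval_hom _ P (mix_star_hom (fb k) eE eS)).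
  rewrite (starpoly_eval_pair (fun A : 'M[C]_((n1 k).+1) => A^t*)
    (fun A : 'M[C]_((n2 k).+1) => A^t*)); congr (mix _ _ (_, _)).
    by apply: eval_subst_starpoly; [exact: starmx1|move=> c a; exact: adjmxZ].
  by apply: eval_subst_starpoly; [exact: starmx1|move=> c a; exact: adjmxZ].
have q1 : `|ratr q : C| <= 1 /\ `|1 - ratr q : C| <= 1.
  have /andP[q0 /ltW q1] := q01.
  have qC0 : 0 <= ratr q :> C by rewrite ler0q ltW.
  have qC1 : ratr q <= 1 :> C by rewrite -(rmorph1 (ratr : rat -> C)) ler_rat.
  by rewrite !ger0_norm ?subr_ge0//; split=> //; rewrite lerBlDr lerDl.
exists N, (fun k i => mix (f k) e (Z1 k i, Z2 k i)); split.
- move=> i.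
  have Y1gb : galois_bounded (fun k => oapp (X1 k) 1 (l1 i).2).
    by case: (l1 i).2 => [j|]; [exact: X1gb|exact: galois_bounded1].
  have Y2gb : galois_bounded (fun k => oapp (X2 k) 1 (l2 i).2).
    by case: (l2 i).2 => [j|]; [exact: X2gb|exact: galois_bounded1].
  (* Each generator lives in one summand only, so its microstate is a single amplification and
     [galois_bounded_amplify] applies. *)
  have : ((l1 i).1 = B /\ (l2 i).1 = 0) \/ ((l1 i).1 = 0 /\ (l2 i).1 = B).
    have := l1E i; have := l2E i.
    by case: (\val i) => [[j|j]|] [<- _] [<- _]; [left|right|left].
  case=> -[c1 c2].
    have -> : (fun k => mix (f k) e (Z1 k i, Z2 k i)) =
        (fun k => amplify (f k) (oapp (X1 k) 1 (l1 i).2) (B *: e)).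
      apply: functional_extensionality_dep => k; rewrite /mix /Z1 /Z2 /= !amplifyZ c1 c2 scale0r.
      by rewrite amplify0 addr0.
    apply: galois_bounded_amplify => // s t; rewrite mxE; exact: e_int.
  have -> : (fun k => mix (f k) e (Z1 k i, Z2 k i)) =
      (fun k => amplify (swap_index (f k)) (oapp (X2 k) 1 (l2 i).2) (B *: (1 - e))).
    apply: functional_extensionality_dep => k; rewrite /mix /Z1 /Z2 /= !amplifyZ c1 c2 scale0r.
    by rewrite amplify0 add0r.
  apply: galois_bounded_amplify => // [k|s t]; first exact: (swap_index_bij (fb k)).
  by rewrite mxE; exact: e1_int.
- move=> P.
  have -> : tau (starpoly_eval (@vn_star R (tracial_sum M1 M2 q01))
      (fun i : F => (y1 (\val i), y2 (\val i))) P) =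
      ratr q * tau (starpoly_eval (@vn_star R M1) (fun i : F1 => x1 (\val i)) (P1 P)) +
      (1 - ratr q) *
        tau (starpoly_eval (@vn_star R M2) (fun i : F2 => x2 (\val i)) (P2 P)).
    rewrite -[LHS]/(sum_tau q (starpoly_eval (A := (vn_alg M1 * vn_alg M2)%type)
      (fun a => (vn_star a.1, vn_star a.2)) (fun i : F => (y1 (\val i), y2 (\val i))) P)).
    rewrite starpoly_eval_pair /sum_tau /=; congr (_ + _); congr (_ * _); congr (tau _).
      rewrite -(eval_subst_starpoly (conj := Num.conj)); last 2 first.
      + exact: vn_star1.
      + by move=> c a; exact: vn_starZ.
      apply: eq_starpoly_eval => i /=; rewrite /y1 l1E /=.
      by case: (l1 i).2.
    rewrite -(eval_subst_starpoly (conj := Num.conj)); last 2 first.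
    + exact: vn_star1.
    + by move=> c a; exact: vn_starZ.
    apply: eq_starpoly_eval => i /=; rewrite /y2 l2E /=.
    by case: (l2 i).2.
  rewrite /tends_to.
  have -> : (fun k => ntr (mx_eval (fun i => mix (f k) e (Z1 k i, Z2 k i)) P)) =
    (fun k => ratr q * ntr (mx_eval (X1 k) (P1 P)) +
              (1 - ratr q) * ntr (mx_eval (X2 k) (P2 P))).
    by apply/funext => k; rewrite eval_mix (ntr_mix (fb k) e_diag).
  by apply: cvgD; apply: cvgMl_tmp; [exact: X1ms|exact: X2ms].
- move=> P; rewrite /asymptotically_constant.
  pose u k := norm2 (diag_part (mx_eval (X1 k) (P1 P)) -
                     (ntr (mx_eval (X1 k) (P1 P)))%:M).
  pose v k := norm2 (diag_part (mx_eval (X2 k) (P2 P)) -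
                     (ntr (mx_eval (X2 k) (P2 P)))%:M).
  apply: (@tends_to_le _ (fun k => 2 * (u k + v k))) => [k|].
    rewrite eval_mix norm2_ge0 /=.
    by apply: norm2_mix => //; [exact: fb|case: q1|case: q1].
  rewrite /tends_to -(mulr0 2) -[X in 2 * X](addr0 0).
  by apply: cvgMl_tmp; apply: cvgD; [exact: X1ac|exact: X2ac].
Qed.

End DirectSum.

(** * Finite-dimensional tracial von Neumann algebras *)

Section AtomicProjections.
Variables (R : realType) (M : tracialVnAlg R).
Local Notation C := R[i].
Local Notation star := (@vn_star R M).

Lemma tau0 : tau (0 : M) = 0.
Proof.
have := tau_linear 1 (0 : M) 0; rewrite scale1r addr0 mul1r => /eqP.
by rewrite -subr_eq0 opprD addNKr oppr_eq0 => /eqP.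
Qed.

Lemma tauZ (c : C) (a : M) : tau (c *: a) = c * tau a.
Proof. by rewrite -[c *: a]addr0 tau_linear tau0 addr0. Qed.

Lemma tauD (a b : M) : tau (a + b) = tau a + tau b.
Proof. by rewrite -[a]scale1r tau_linear mul1r scale1r. Qed.

Lemma tau_sum (I : Type) (r : seq I) (P : pred I) (F : I -> M) :
  tau (\sum_(i <- r | P i) F i) = \sum_(i <- r | P i) tau (F i).
Proof. by apply: (big_morph (@tau R M)); [exact: tauD|exact: tau0]. Qed.

Lemma tau_sq_eq0 (a : M) : a != 0 -> 0 < tau (star a * a).
Proof.
move=> a0; rewrite lt_neqAle tau_sq_ge0 andbT eq_sym.
by apply: contra_neq a0 => /tau_faithful.
Qed.

Lemma star_mul_neq0 (a : M) : a != 0 -> a * star a != 0.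
Proof.
move=> a0; apply: contraTneq (tau_sq_eq0 a0) => h.
by rewrite tau_trace h tau0 ltxx.
Qed.

Definition projection (e : M) := star e = e /\ e * e = e.

Lemma projection_tau_gt0 e : projection e -> e != 0 -> 0 < tau e.
Proof. by move=> [se ee] /tau_sq_eq0; rewrite se ee. Qed.

(** For projections, [e * g = g] says that [g] lies below [e]. *)
Definition atomic (e : M) := forall g, projection g -> e * g = g -> g = 0 \/ g = e.

Lemma scale_eq (c d : C) (a : M) : a != 0 -> c *: a = d *: a -> c = d.
Proof.
move=> a0 /eqP; rewrite -subr_eq0 -scalerBl scaler_eq0 (negbTE a0) orbF.
by rewrite subr_eq0 => /eqP.
Qed.

Hypothesis fdM : finite_dimensional M.

Lemma linear_dependence : exists n, forall w : 'I_n.+1 -> M,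
  exists2 u : 'I_n.+1 -> C, (exists i, u i != 0) & \sum_i u i *: w i = 0.
Proof.
have [n [b bP]] := fdM; exists n => w.
have /choice[c cE] : forall i, exists c : 'I_n -> C, w i = \sum_j c j *: b j.
  by move=> i; exact: bP.
pose A : 'M[C]_(n.+1, n) := \matrix_(i, j) c i j.
have : kermx A != 0.
  rewrite -mxrank_eq0 mxrank_ker -lt0n subn_gt0.
  by rewrite ltnS rank_leq_col.
move=> /rowV0Pn[u /sub_kermxP uA u0].
have [i ui] : exists i, u 0 i != 0 by apply/rV0Pn.
exists (fun i => u 0 i); first by exists i.
under eq_bigr => k _ do rewrite cE scaler_sumr.
rewrite exchange_big big1// => j _.
have /matrixP/(_ 0 j) := uA; rewrite !mxE => h.
under eq_bigr do rewrite scalerA.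
rewrite -scaler_suml -[X in X *: _ = _]/(\sum_i u 0 i * c i j).
have -> : \sum_i u 0 i * c i j = 0.
  by rewrite -[RHS]h; apply: eq_bigr => k _; rewrite mxE.
by rewrite scale0r.
Qed.

(** The powers of [x] are linearly dependent, and the resulting polynomial splits into linear
    factors. *)
Lemma annihilating_polynomial (x : M) :
  exists l : seq C, \prod_(c <- l) (x - c%:A) = 0.
Proof.
have [n hn] := linear_dependence.
have [u [i ui] us] := hn (fun i => x ^+ i).
pose p : {poly C} := \poly_(k < n.+1) u (inord k).
have p0 : p != 0.
  apply: contraNneq ui => /(congr1 (fun p : {poly C} => p`_i)).
  by rewrite coef_poly ltn_ord inord_val coef0 => ->.
have [l pl] := closed_field_poly_normal p.
exists l; apply/eqP.
have : horner_alg x p = 0.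
  rewrite /p poly_def rmorph_sum /= -[RHS]us; apply: eq_bigr => k _.
  by rewrite linearZ /= rmorphXn /= horner_algX inord_val mulr_algl.
rewrite pl linearZ /= mulr_algl => /eqP; rewrite scaler_eq0 lead_coef_eq0 (negbTE p0) /=.
rewrite rmorph_prod; congr (_ == _); apply: eq_bigr => c _.
by rewrite rmorphB /= horner_algX horner_algC.
Qed.

Section Spectral.
Variables (e x : M).
Hypotheses (pe : projection e) (e0 : e != 0) (ae : atomic e).
Hypotheses (sx : star x = x) (ex : e * x = x).

Let xe : x * e = x.
Proof. by have := congr1 star ex; rewrite vn_starM sx pe.1. Qed.

Let pr (l : seq C) : M := \prod_(c <- l) (x - c%:A).

Let prE l : e * pr l = pr l * e.
Proof.
rewrite /pr; elim: l => [|c l IH]; first by rewrite big_nil mulr1 mul1r.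
rewrite big_cons mulrA -mulrA -[RHS]mulrA -IH !mulrA; congr (_ * _).
by rewrite mulrBr mulrBl ex xe -scalerAr -scalerAl mulr1 mul1r.
Qed.

Let pr_eigen (l : seq C) (c : C) (h : M) : x * h = c *: h ->
  exists d, pr l * h = d *: h.
Proof.
move=> xh; rewrite /pr; elim: l => [|a l [d IH]].
  by exists 1; rewrite big_nil mul1r scale1r.
exists (d * (c - a)); rewrite big_cons -mulrA IH -scalerAr mulrBl xh.
by rewrite -scalerAl mul1r -scalerBl scalerA.
Qed.

Let star_pr_eigen (l : seq C) (c : C) (h : M) : x * h = c *: h ->
  exists d, star (pr l) * h = d *: h.
Proof.
move=> xh; rewrite /pr; elim: l => [|a l [d IH]].
  by exists 1; rewrite big_nil vn_star1 mul1r scale1r.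
exists ((c - a^*) * d); rewrite big_cons vn_starM -mulrA.
rewrite vn_starB sx vn_starZ vn_star1 mulrBl xh -scalerAl mul1r -scalerBl.
by rewrite -scalerAr IH scalerA.
Qed.

(* An eigenprojection of [x] below [e] must be [e] itself. *)
Lemma atomic_selfadjoint_scalar : exists c : C, x = c *: e.
Proof.
have [l l0] := annihilating_polynomial x.
(* The product, multiplied by [e], vanishes for the full list but not for the empty one. At the
   factor where it first becomes 0, what stands to its right is an eigenvector [y] of [x]. *)
have [c [l' [y0 xy]]] : exists c l', pr l' * e != 0 /\ (x - c%:A) * (pr l' * e) = 0.
  have : pr l * e = 0 by rewrite /pr l0 mul0r.
  elim: {l0} l => [|c l IH]; first by rewrite /pr big_nil mul1r => /eqP; rewrite (negbTE e0).
  have [/IH//|h] := eqVneq (pr l * e) 0.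
  by rewrite /pr big_cons -mulrA => hc; exists c, l.
set y := pr l' * e in y0 xy; pose h := y * star y.
have h0 : h != 0 by exact: star_mul_neq0.
have sh : star h = h by rewrite /h vn_starM vn_starK.
have ey : e * y = y by rewrite /y mulrA prE -mulrA pe.2.
have eh : e * h = h by rewrite /h mulrA ey.
have xh : x * h = c *: h.
  move/eqP: xy; rewrite mulrBl subr_eq0 -scalerAl mul1r => /eqP xy.
  by rewrite /h mulrA xy -scalerAl.
have [d1 hd1] := pr_eigen l' xh; have [d2 hd2] := star_pr_eigen l' xh.
(* [y] and [star y] are products of linear factors in [x], times [e], so both act on the eigenvector
   [h] as scalars. *)
have hh : h * h = (d2 * d1) *: h.
  have syh : star y * h = d2 *: h by rewrite /y vn_starM pe.1 -mulrA hd2 -scalerAr eh.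
  have yh : y * h = d1 *: h by rewrite /y -mulrA eh.
  by rewrite {1}/h -mulrA syh -scalerAr yh scalerA.
set d := d2 * d1 in hh.
have d0 : d != 0.
  apply: contraTneq (tau_sq_eq0 h0) => d0.
  by rewrite sh hh d0 scale0r tau0 ltxx.
have dr : d^* = d.
  by apply: (scale_eq h0); rewrite -hh -[in RHS]sh -vn_starM hh vn_starZ sh.
have pg : projection (d^-1 *: h).
  split; first by rewrite vn_starZ fmorphV /= dr sh.
  by rewrite -scalerAl -scalerAr hh !scalerA -mulrA mulVf// mulr1.
(* Rescaled, [h] is a nonzero projection below [e], hence equal to [e]. *)
have [g0|gE] := ae pg (etrans (esym (scalerAr _ _ _)) (congr1 _ eh)).
  move/eqP: g0; rewrite scaler_eq0 invr_eq0 (negbTE d0) /=.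
  by rewrite (negbTE h0).
by exists c; rewrite -[LHS]xe -gE -scalerAr xh scalerA mulrC -scalerA.
Qed.

End Spectral.

(** The selfadjoint case is applied to [z + star z] and ['i *: (z - star z)], from which [z] is
    recovered. *)
Lemma atomic_corner_scalar e (a : M) : projection e -> e != 0 -> atomic e ->
  exists c : C, e * a * e = c *: e.
Proof.
move=> pe e0 ae; set z := e * a * e.
have ez : e * z = z by rewrite /z !mulrA pe.2.
have ze : z * e = z by rewrite /z -!mulrA pe.2.
have esz : e * star z = star z by rewrite -[in LHS]pe.1 -vn_starM ze.
have [||c1 h1] := @atomic_selfadjoint_scalar e (z + star z) pe e0 ae.
- by rewrite vn_starD vn_starK addrC.
- by rewrite mulrDr ez esz.
have [||c2 h2] := @atomic_selfadjoint_scalar e ('i *: (z - star z)) pe e0 ae.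
- by rewrite vn_starZ vn_starB vn_starK conjCi scaleNr -scalerN opprB.
- by rewrite -scalerAr mulrBr ez esz.
exists ((c1 - 'i * c2) / 2).
have z2 : 2 *: z = (z + star z) - 'i *: ('i *: (z - star z)).
  rewrite scalerA -expr2 sqrCi scaleN1r opprK addrACA addrA -addrA subrr addr0.
  by rewrite scaler_nat mulr2n.
have : 2 *: z = (c1 - 'i * c2) *: e by rewrite z2 h1 h2 scalerA -scalerBl.
by move=> h; rewrite mulrC -scalerA -h scalerA mulVf ?pnatr_eq0// scale1r.
Qed.

Definition orthogonal_family (T : finType) (e : T -> M) :=
  (forall i, projection (e i) /\ e i != 0) /\
  (forall i j, i != j -> e i * e j = 0).

(** Nonzero orthogonal projections are linearly independent: multiplying a relation by [e (i k)]
    isolates one coefficient. *)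
Lemma orthogonal_family_bound : exists n, forall (T : finType) (e : T -> M),
  orthogonal_family e -> (#|T| <= n)%N.
Proof.
have [n hn] := linear_dependence; exists n => T e [pe oe].
rewrite leqNgt; apply/negP => nT.
pose i (k : 'I_n.+1) : T := enum_val (widen_ord nT k).
have iinj k k' : k != k' -> i k != i k'.
  apply: contraNneq => /enum_val_inj/(congr1 val) /= kk'.
  exact/eqP/val_inj.
have [u [k uk] us] := hn (e \o i).
have /eqP := congr1 (fun a => e (i k) * a) us.
rewrite mulr0 mulr_sumr (bigD1 k)//= big1 ?addr0 => [|k' k'k]; last first.
  by rewrite -scalerAr oe ?scaler0// iinj// eq_sym.
by rewrite -scalerAr (pe _).1.2 scaler_eq0 (negbTE uk) (negbTE (pe _).2).
Qed.

(** A family of maximal cardinality works, since failure of either atomicity or completeness would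
    allow one more member. *)
Lemma atomic_partition : exists (T : finType) (e : T -> M),
  [/\ orthogonal_family e, forall i, atomic (e i) & \sum_i e i = 1].
Proof.
have [n hn] := orthogonal_family_bound.
pose P m := `[< exists (T : finType) (e : T -> M),
  #|T| = m /\ orthogonal_family e >].
have P0 : exists m, P m.
  exists 0%N; apply/asboolP; exists void, (fun v : void => match v with end).
  by split; [exact: card_void|split=> -[]].
have Pb m : P m -> (m <= n)%N.
  by move=> /asboolP[T [e [<- /hn]]].
case: (ex_maxnP P0 Pb) => m /asboolP[T [e [Tm fe]]] mmax; exists T, e.
have extend (e' : option T -> M) : ~ orthogonal_family e'.
  move=> fe'; have : P m.+1.
    by apply/asboolP; exists (option T), e'; rewrite card_option Tm.
  by move/mmax; rewrite ltnn.
have [pe oe] := fe; split=> //.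
  move=> i g [sg gg] eg; have [->|g0] := eqVneq g 0; first by left.
  have [->|gei] := eqVneq g (e i); first by right.
  have [[sei eei] _] := pe i.
  have ge : g * e i = g by have := congr1 star eg; rewrite vn_starM sei sg.
  have gej j : j != i -> g * e j = 0.
    by move=> ji; rewrite -ge -mulrA oe ?mulr0// eq_sym.
  have ejg j : j != i -> e j * g = 0.
    by move=> ji; rewrite -eg mulrA oe ?mul0r.
  (* A projection [g] strictly between 0 and [e i] splits [e i] into [g] and [e i - g]. *)
  exfalso; apply: (extend (fun o =>
    if o is Some j then if j == i then e i - g else e j else g)).
  split=> [[j|]|[j|] [k|]] //=.
  - have [_|_] := eqVneq j i; last exact: pe.
    split; last by rewrite subr_eq0 eq_sym.
    split; first by rewrite vn_starB sei sg.
    by rewrite mulrBr !mulrBl eei ge eg gg subrr subr0.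
  - rewrite (inj_eq Some_inj); have [->|ji] := eqVneq j i.
      rewrite eq_sym; have [_|ki _] := eqVneq k i => //.
      by rewrite mulrBl oe ?gej ?subr0// eq_sym.
    have [->|ki] := eqVneq k i => jk; last exact: oe.
    by rewrite mulrBr oe// ejg ?subr0.
  - have [_ _|ji _] := eqVneq j i; last exact: ejg.
    by rewrite mulrBl eg gg subrr.
  - have [_ _|ki _] := eqVneq k i; last exact: gej.
    by rewrite mulrBr ge gg subrr.
(* If the sum is not 1, the defect [f] is a nonzero projection orthogonal to the family. *)
apply/eqP; rewrite eq_sym -subr_eq0; apply/negPn/negP => f0.
set f := 1 - _ in f0.
have ef j : e j * f = 0.
  rewrite mulrBr mulr1 mulr_sumr (bigD1 j)//= (pe j).1.2 big1 ?addr0 ?subrr//.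
  by move=> k kj; rewrite oe// eq_sym.
have sf : star f = f.
  rewrite vn_starB vn_star1 vn_star_sum; congr (_ - _).
  by apply: eq_bigr => j _; exact: (pe j).1.1.
have fej j : f * e j = 0.
  by have := congr1 star (ef j); rewrite vn_starM sf (pe j).1.1 vn_star0.
apply: (extend (fun o => if o is Some j then e j else f)).
split=> [[j|]|[j|] [k|]] //=; last exact: oe.
split=> //; split=> //.
by rewrite {2}/f mulrBr mulr1 mulr_sumr big1 ?subr0.
Qed.

End AtomicProjections.

(** * Matrix units between minimal projections *)

Section MatrixUnits.
Variables (R : realType) (M : tracialVnAlg R).
Local Notation C := R[i].
Local Notation star := (@vn_star R M).
Hypothesis fdM : finite_dimensional M.
Variables (T : finType) (e : T -> M).
Hypothesis oe : orthogonal_family e.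
Hypothesis ae : forall i, atomic (e i).
Hypothesis e1 : \sum_i e i = 1.

Let se i : star (e i) = e i. Proof. exact: (oe.1 i).1.1. Qed.
Let ee i : e i * e i = e i. Proof. exact: (oe.1 i).1.2. Qed.
Let e_neq0 i : e i != 0. Proof. exact: (oe.1 i).2. Qed.
Let e_orth i j : i != j -> e i * e j = 0. Proof. exact: oe.2. Qed.
Let tau_e_gt0 i : 0 < tau (e i).
Proof. by apply: projection_tau_gt0; [exact: (oe.1 i).1|exact: (oe.1 i).2]. Qed.

(** By [linked_isometry] this is Murray-von Neumann equivalence of [e i] and [e j]. *)
Definition linked i j : bool := `[< exists a : M, e i * a * e j != 0 >].

(** For a nonzero [x] in the corner, [x * star x] and [star x * x] are multiples of [e i] and [e j]
    by atomicity. Computing [x * star x * x] in two ways shows that the scalars agree; the common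
    value is positive, and [x] is divided by its square root. *)
Lemma linked_isometry i j : linked i j -> exists v : M,
  [/\ e i * v = v, v * e j = v, v * star v = e i & star v * v = e j].
Proof.
move=> /asboolP[a x0]; set x := e i * a * e j in x0.
have eix : e i * x = x by rewrite /x !mulrA ee.
have xej : x * e j = x by rewrite /x -!mulrA ee.
have ejx : e j * star x = star x by rewrite -{1}(se j) -vn_starM xej.
have xei : star x * e i = star x by rewrite -{1}(se i) -vn_starM eix.
have [l lE] : exists l : C, x * star x = l *: e i.
  have [l lE] := atomic_corner_scalar fdM (x * star x) (oe.1 i).1 (e_neq0 i) (@ae i).
  by exists l; rewrite -lE mulrA eix -mulrA xei.
have [l' lE'] : exists l : C, star x * x = l *: e j.
  have [l' lE'] := atomic_corner_scalar fdM (star x * x) (oe.1 j).1 (e_neq0 j) (@ae j).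
  by exists l'; rewrite -lE' mulrA ejx -mulrA xej.
have ll' : l = l'.
  apply: (scale_eq x0); rewrite -{1}eix scalerAl -lE.
  by rewrite -mulrA lE' -scalerAr xej.
rewrite -{}ll' in lE'.
have l_gt0 : 0 < l.
  have := tau_sq_eq0 x0; rewrite lE' tauZ.
  by rewrite pmulr_lgt0.
have sl0 : sqrtC l != 0 by rewrite sqrtC_eq0 gt_eqF.
have cs : (sqrtC l)^-1^* = (sqrtC l)^-1.
  by apply: geC0_conj; rewrite invr_ge0 sqrtC_ge0 ltW.
have ssl : (sqrtC l)^-1 * (sqrtC l)^-1 * l = 1.
  by rewrite -invfM -expr2 sqrtCK mulVf// gt_eqF.
exists ((sqrtC l)^-1 *: x); split.
- by rewrite -scalerAr eix.
- by rewrite -scalerAl xej.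
- by rewrite vn_starZ cs -scalerAl -scalerAr lE !scalerA ssl scale1r.
- by rewrite vn_starZ cs -scalerAl -scalerAr lE' !scalerA ssl scale1r.
Qed.

Lemma linked_refl i : linked i i.
Proof. by apply/asboolP; exists 1; rewrite mulr1 ee. Qed.

Lemma linked_sym i j : linked i j -> linked j i.
Proof.
move=> /asboolP[a h]; apply/asboolP; exists (star a).
apply: contra_neq h => h; apply: (can_inj (@vn_starK R M)).
by rewrite !vn_starM !se mulrA h vn_star0.
Qed.

Lemma linked_trans i j k : linked i j -> linked j k -> linked i k.
Proof.
move=> /linked_isometry[v [iv vj vv _]] /linked_isometry[w [jw wk ww _]].
apply/asboolP; exists (v * w); rewrite !mulrA iv -mulrA wk.
apply/eqP => h; have := congr1 (fun a => a * star w) h.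
rewrite -mulrA ww vj mul0r => v0; move: vv; rewrite v0 mul0r => /esym/eqP.
by rewrite (negbTE (e_neq0 i)).
Qed.

Definition root i : T := odflt i [pick j | linked i j].

Lemma linked_root i : linked i (root i).
Proof. by rewrite /root; case: pickP => //= _; exact: linked_refl. Qed.

Lemma eq_root i j : linked i j -> root i = root j.
Proof.
move=> ij; rewrite /root.
have -> : [pick k | linked i k] = [pick k | linked j k].
  apply: eq_pick => k /=; apply/idP/idP => h.
    exact: linked_trans (linked_sym ij) h.
  exact: linked_trans ij h.
(* The defaults [i] and [j] differ, but reflexivity rules out the empty case. *)
by case: pickP => // /(_ j); rewrite linked_refl.
Qed.

Lemma root_idem i : root (root i) = root i.
Proof. by apply/esym/eq_root; exact: linked_root. Qed.

Lemma corner_eq0 i j (a : M) : root i != root j -> e i * a * e j = 0.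
Proof.
move=> ij; apply/eqP; apply: contraNT ij => h; apply/eqP/eq_root.
by apply/asboolP; exists a.
Qed.

(* [v i] maps the root of the class of [i] onto [i]; the elements              *)
(* [v i * star (v j)] with [root i = root j] are matrix units.                 *)
Variable v : T -> M.
Hypothesis ev : forall i, e i * v i = v i.
Hypothesis ve : forall i, v i * e (root i) = v i.
Hypothesis vv : forall i, v i * star (v i) = e i.
Hypothesis v_v : forall i, star (v i) * v i = e (root i).

(** The scalar by which [star (v i) * a * v j] is a multiple of [e (root j)], read off with the
    trace; it is 0 for indices in different classes. *)
Definition coef (a : M) i j : C :=
  tau (star (v i) * a * v j) / tau (e (root j)).

Let tau_e_neq0 i : tau (e i) != 0. Proof. by rewrite gt_eqF. Qed.

Let ve' i : e (root i) * star (v i) = star (v i).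
Proof. by rewrite -{1}se -vn_starM ve. Qed.

Let ev' i : star (v i) * e i = star (v i).
Proof. by rewrite -{1}se -vn_starM ev. Qed.

Let cornerE i j (a : M) :
  star (v i) * a * v j = e (root i) * (star (v i) * a * v j) * e (root j).
Proof. by rewrite !mulrA ve' -!mulrA ve. Qed.

Lemma compress i j (a : M) : star (v i) * a * v j = coef a i j *: e (root j).
Proof.
have zE := cornerE i j a.
have [rr|rr] := eqVneq (root i) (root j); last first.
  by rewrite /coef zE corner_eq0 ?tau0 ?mul0r ?scale0r// !root_idem.
have [l lE] := atomic_corner_scalar fdM (star (v i) * a * v j)
  (oe.1 (root j)).1 (e_neq0 _) (@ae (root j)).
rewrite rr lE in zE; rewrite /coef zE tauZ mulfK//.
Qed.

Lemma coefE i j (a : M) c : star (v i) * a * v j = c *: e (root j) ->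
  coef a i j = c.
Proof. by rewrite compress; exact: scale_eq. Qed.

Lemma coef_eq0 i j (a : M) : root i != root j -> coef a i j = 0.
Proof.
move=> rr; apply: coefE.
by rewrite scale0r cornerE corner_eq0 // !root_idem.
Qed.

Lemma coef_linear (c : C) (a b : M) i j :
  coef (c *: a + b) i j = c * coef a i j + coef b i j.
Proof.
apply: coefE; rewrite mulrDr mulrDl -scalerAr -scalerAl !compress.
by rewrite scalerDl scalerA.
Qed.

Lemma coef1 i j : coef 1 i j = (i == j)%:R.
Proof.
apply: coefE; rewrite mulr1.
have [->|ij] := eqVneq i j; first by rewrite v_v scale1r.
by rewrite scale0r -ev' -[v j]ev -mulrA (mulrA (e i)) e_orth// mul0r mulr0.
Qed.

Lemma coef_star (a : M) i j : coef (star a) i j = (coef a j i)^*.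
Proof.
have [rr|rr] := eqVneq (root i) (root j); last first.
  by rewrite !coef_eq0 ?rmorph0// eq_sym.
apply: coefE.
have -> : star (v i) * star a * v j = star (star (v j) * a * v i).
  by rewrite !vn_starM vn_starK mulrA.
by rewrite compress vn_starZ se rr.
Qed.

(** Insert [1 = \sum_j v j * star (v j)] between [a] and [b]. *)
Lemma coefM (a b : M) i k : coef (a * b) i k = \sum_j coef a i j * coef b j k.
Proof.
apply: coefE; rewrite -[a in LHS]mulr1 -e1 mulr_sumr mulr_suml mulr_sumr mulr_suml.
rewrite scaler_suml; apply: eq_bigr => j _.
have -> : star (v i) * (a * e j * b) * v k =
    (star (v i) * a * v j) * (star (v j) * b * v k).
  by rewrite -vv !mulrA.
rewrite !compress -scalerAl -scalerAr scalerA.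
have [->|rr] := eqVneq (root j) (root k); first by rewrite ee.
by rewrite (coef_eq0 b rr) mulr0 !scale0r.
Qed.

Lemma tau_root i : tau (e (root i)) = tau (e i).
Proof. by rewrite -v_v tau_trace vv. Qed.

(** Insert the same decomposition of 1 and move [v i] around the trace. *)
Lemma tau_coef (a : M) : tau a = \sum_i coef a i i * tau (e i).
Proof.
rewrite -[a in LHS]mul1r -e1 mulr_suml tau_sum; apply: eq_bigr => i _.
by rewrite -[e i in LHS]vv -mulrA tau_trace compress tauZ tau_root.
Qed.

Lemma coef_unit i j k l : coef (v i * star (v j)) k l =
  ([&& k == i, j == l & root i == root j])%:R.
Proof.
apply: coefE.
have -> : star (v k) * (v i * star (v j)) * v l =
   (star (v k) * 1 * v i) * (star (v j) * 1 * v l) by rewrite !mulr1 !mulrA.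
rewrite !compress !coef1 -scalerAl -scalerAr scalerA.
have [ki|_] := eqVneq k i; last by rewrite mul0r !scale0r.
have [<-|_] := eqVneq j l; last by rewrite mulr0 !scale0r.
have [->|rr] := eqVneq (root i) (root j); first by rewrite mul1r ee.
by rewrite e_orth// scaler0 scale0r.
Qed.

Lemma unit_span (a : M) :
  a = \sum_i \sum_j coef a i j *: (v i * star (v j)).
Proof.
rewrite -[LHS]mul1r -[LHS]mulr1 -e1 mulr_suml mulr_suml; apply: eq_bigr => i _.
rewrite mulr_sumr; apply: eq_bigr => j _.
have -> : e i * a * e j = v i * (star (v i) * a * v j) * star (v j).
  by rewrite -!vv !mulrA.
by rewrite compress -scalerAr -scalerAl -mulrA ve'.
Qed.

(** Corners between different classes vanish, so [p * a = p * a * p]; applied to [star a], this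
    gives [a * p = p * a * p]. *)
Lemma class_central i :
  central_projection (\sum_(j | root j == root i) e j).
Proof.
set p := \sum_(j | _) _.
have ap (a : M) : p * a = p * a * p.
  rewrite -[p * a in LHS]mulr1 -e1 (bigID (fun j => root j == root i)) /=.
  rewrite mulrDr [X in _ + X]mulr_sumr [X in _ + X]big1 ?addr0// => k ki.
  rewrite /p !mulr_suml big1// => j /eqP ji; apply: corner_eq0.
  by rewrite ji eq_sym.
have sp : star p = p.
  rewrite /p [LHS](big_morph star (@vn_starD R M) (vn_star0 M)).
  by apply: eq_bigr => j _; exact: se.
split=> //; first by have := ap 1; rewrite mulr1 => <-.
move=> a; rewrite ap -[in RHS](vn_starK a) -sp -vn_starM ap.
by rewrite !vn_starM vn_starK sp mulrA.
Qed.

Lemma tau_class i : tau (\sum_(j | root j == root i) e j) =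
  #|[pred j | root j == root i]|%:R * tau (e i).
Proof.
rewrite tau_sum (eq_bigr (fun=> tau (e i))) => [|j /eqP ji].
  by rewrite sumr_const mulr_natl.
by rewrite -tau_root ji tau_root.
Qed.

End MatrixUnits.

Lemma common_denominator (T : finType) (t : T -> rat) : (forall i, 0 < t i) ->
  exists d (s : T -> nat), forall i, t i = (s i)%:R / d.+1%:R.
Proof.
move=> t0; pose D := (\prod_i `|denq (t i)|)%N.
have D0 : (0 < D)%N by rewrite prodn_gt0// => i; rewrite absz_gt0 denq_neq0.
exists D.-1, (fun i => `|numq (t i)| * \prod_(j | j != i) `|denq (t j)|)%N => i.
rewrite prednK//= /D [X in _ / X%:R](bigD1 i)//= !natrM -mulf_div divff ?mulr1; last first.
  rewrite pnatr_eq0 -lt0n prodn_cond_gt0// => j _.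
  by rewrite absz_gt0 denq_neq0.
by rewrite -[LHS]divq_num_den !natr_absz !gtr0_norm// numq_gt0.
Qed.

(** * Algebraic soficity in finite dimension *)

Section FiniteDimensional.
Variables (R : realType) (M : tracialVnAlg R).
Local Notation C := R[i].
Local Notation star := (@vn_star R M).

(** The constant sequence [phi (x l)] has exactly the right moments, and every polynomial in it has
    an exactly constant diagonal. *)
Lemma algebraically_sofic_of_representation (I : finType) (x : I -> M) p
    (phi : M -> 'M[C]_(p.+1)) :
  (forall a : M, exists c : I -> C, a = \sum_i c i *: x i) ->
  star_hom star (fun A : 'M[C]_(p.+1) => A^t*) phi ->
  (forall a i, phi a i i = tau a) ->
  (forall l i j, algebraic_integer (phi (x l) i j)) ->
  algebraically_sofic M.
Proof.
move=> xs phiH phid phii; exists I, x; split; first exact: spanning_generates.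
move=> F finF; exists (fun=> p), (fun _ l => phi (x (\val l))).
have phitr a : ntr (phi a) = tau a.
  rewrite /ntr /mxtrace (eq_bigr (fun=> tau a)) => [|i _]; last exact: phid.
  by rewrite sumr_const card_ord -[_ *+ _]mulr_natr mulfK// pnatr_eq0.
have eval_phi (P : starpoly C F) : mx_eval (fun l => phi (x (\val l))) P =
    phi (starpoly_eval star (fun l => x (\val l)) P).
  by rewrite (starpoly_eval_hom _ P phiH).
split.
- by move=> l; apply: galois_bounded_cst; exact: phii.
- move=> P; rewrite /tends_to eval_phi phitr; exact: cvg_cst.
- move=> P; rewrite /asymptotically_constant /tends_to eval_phi phitr.
  have -> : norm2 (diag_part (phi (starpoly_eval star (fun l : F => x (\val l)) P)) -
      (tau (starpoly_eval star (fun l : F => x (\val l)) P))%:M) = 0.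
    apply/eqP; rewrite -sqrf_eq0 norm2_diag_part big1 ?mul0r// => i _.
    by rewrite phid subrr normr0 expr0n.
  exact: cvg_cst.
Qed.

Hypothesis fdM : finite_dimensional M.
Hypothesis rat_trace : forall p : M, central_projection p ->
  exists r : rat, tau p = ratr r.

Lemma algebraically_sofic_finite_dimensional : algebraically_sofic M.
Proof.
have [T [e [oe ae e1]]] := atomic_partition fdM.
have [se ee] : (forall i, star (e i) = e i) /\ (forall i, e i * e i = e i).
  by split=> i; [exact: (oe.1 i).1.1|exact: (oe.1 i).1.2].
pose r := root e.
have /choice[v vP] i := linked_isometry fdM oe ae (linked_root oe i).
have ev i : e i * v i = v i by case: (vP i).
have ve i : v i * e (r i) = v i by case: (vP i).
have vv i : v i * star (v i) = e i by case: (vP i).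
have v_v i : star (v i) * v i = e (r i) by case: (vP i).
pose al := coef e v.
have tau_gt0 i : 0 < tau (e i).
  by apply: projection_tau_gt0; [exact: (oe.1 i).1|exact: (oe.1 i).2].
have tau_r i : tau (e (r i)) = tau (e i) by rewrite -v_v tau_trace vv.
(* The class of [i] sums to a central projection, whose rational trace is the size of the class
   times [tau (e i)]. *)
have /choice[t tE] i : exists t : rat, tau (e i) = ratr t.
  have [u uE] := rat_trace (class_central fdM oe ae e1 i).
  have := tau_class vv v_v i; rewrite uE.
  set n := #|_|; have n0 : n%:R != 0 :> C.
    rewrite pnatr_eq0 -lt0n; apply/card_gt0P; exists i.
    by rewrite inE.
  move=> h; exists (u / n%:R).
  by rewrite fmorph_div rmorph_nat /= h mulrC mulKf.
have t_gt0 i : 0 < t i by have := tau_gt0 i; rewrite tE ltr0q.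
have [d [s sE]] := common_denominator t_gt0.
have d0 : d.+1%:R != 0 :> C by rewrite pnatr_eq0.
have tau_s i : tau (e i) = (s i)%:R / d.+1%:R.
  by rewrite tE sE fmorph_div !rmorph_nat.
(* Multiplicities are constant on classes, so that matrix units can match copies one to one. *)
have s_root i j : r i = r j -> s i = s j.
  move=> rij; have := tau_r i; rewrite rij tau_r !tau_s => /(mulIf (invr_neq0 d0)).
  by move/eqP; rewrite eqr_nat => /eqP.
have sum_s : (\sum_i s i)%N = d.+1.
  apply/eqP; rewrite -(eqr_nat C) natr_sum; apply/eqP.
  have := congr1 (@tau R M) e1; rewrite tau_sum tau_one.
  rewrite (eq_bigr _ (fun i _ => tau_s i)) -mulr_suml.
  by move=> /(canRL (mulfVK d0)); rewrite mul1r.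
(* Coordinate [i] is repeated [s i] times; the total [d.+1] makes the normalized trace of [e i]
   equal to [tau (e i)]. *)
pose U := {i : T & 'I_(s i)}.
have cardU : #|{: U}| = d.+1.
  by rewrite card_tagged sumnE big_map big_enum -sum_s; apply: eq_bigr => i _; rewrite card_ord.
have [u0] : exists u : U, u \in {: U} by apply/card_gt0P; rewrite cardU.
move=> _; have [N [f fb]] := ord_bijection u0.
have Nd : N = d by have := bij_eq_card fb; rewrite cardU card_ord => -[].
rewrite {}Nd {N} in f fb *.
have reidx (G : T -> nat -> C) :
    \sum_z G (tag (f z)) (tagged (f z)) = \sum_i \sum_(k < s i) G i k.
  rewrite sig_big_dep /= [RHS](reindex f)//=; exact: onW_bij.
pose pi (a : M) : 'M[C]_(d.+1) := \matrix_(x, y)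
  (al a (tag (f x)) (tag (f y)) * (tagged (f x) == tagged (f y) :> nat)%:R).
have eq_index x y : (x == y) =
    (tag (f x) == tag (f y)) && (tagged (f x) == tagged (f y) :> nat).
  rewrite -(bij_eq fb); case: (f x) (f y) => i k [j l] /=.
  have [ij|ij] /= := eqVneq i j.
    by case: j / ij l => l; rewrite (eq_Tagged (u := existT _ i k) l).
  by apply/eqP => h; have := congr1 tag h => /= /eqP; rewrite (negbTE ij).
have piH : star_hom star (fun A : 'M[C]_(d.+1) => A^t*) pi.
  split.
  - move=> c a b; apply/matrixP => x y; rewrite !mxE /al.
    by rewrite (coef_linear fdM oe ae ve); ring.
  - move=> a b; apply/matrixP => x y; rewrite !mxE /al.
    rewrite (coefM fdM oe ae e1 ve vv).
    pose G j (k : nat) : C := al a (tag (f x)) j * (tagged (f x) == k :> nat)%:R *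
      (al b j (tag (f y)) * (k == tagged (f y) :> nat)%:R).
    rewrite (eq_bigr (fun z => G (tag (f z)) (tagged (f z)))); last first.
      by move=> z _; rewrite !mxE.
    rewrite reidx mulr_suml; apply: eq_bigr => j _; rewrite /G.
    have [rr|rr] := eqVneq (r (tag (f x))) (r j); last first.
      rewrite (coef_eq0 fdM oe ae ve a rr) !mul0r big1// => k _.
      by rewrite /al (coef_eq0 fdM oe ae ve a rr) !mul0r.
    (* The copy number of [f x] is also valid for [j], because [j] lies in the same class. *)
    have ks : (tagged (f x) < s j)%N by rewrite -(s_root _ _ rr) ltn_ord.
    rewrite (bigD1 (Ordinal ks))//= eqxx mulr1 big1 ?addr0 ?mulrA// => k.
    by rewrite -val_eqE /= eq_sym => /negbTE ->; rewrite mulr0 mul0r.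
  - apply/matrixP => x y; rewrite !mxE /al (coef1 fdM oe ae ev ve v_v).
    by rewrite -natrM mulnb eq_index.
  - move=> a; apply/matrixP => x y; rewrite !mxE /al (coef_star fdM oe ae ve).
    by rewrite [RHS]rmorphM rmorph_nat eq_sym.
have pi_tr a : ntr (pi a) = tau a.
  rewrite (tau_coef fdM oe ae e1 ve vv v_v) /ntr /mxtrace.
  pose G i (_ : nat) := al a i i.
  have -> : \sum_z pi a z z = \sum_z G (tag (f z)) (tagged (f z)).
    by apply: eq_bigr => z _; rewrite mxE eqxx mulr1.
  rewrite reidx mulr_suml; apply: eq_bigr => i _.
  by rewrite sumr_const card_ord tau_s mulrA mulr_natr.
have [p [Psi [[PL PM P1 PS] Pd Pi]]] := constant_diagonal_embedding R d.
have PsiH : star_hom star (fun A : 'M[C]_(p.+1) => A^t*) (Psi \o pi).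
  have [piL piM pi1 piS] := piH; split.
  - by move=> c a b; rewrite /= piL PL.
  - by move=> a b; rewrite /= piM PM.
  - by rewrite /= pi1 P1.
  - by move=> a; rewrite /= piS PS.
(* The scaled matrix units span [M]; [pi] maps matrix units to 0-1 matrices, and the factor [d.+1]
   is the one that makes [Psi] integral. *)
apply: (@algebraically_sofic_of_representation (T * T)%type
  (fun ij => d.+1%:R *: (v ij.1 * star (v ij.2))) p (Psi \o pi)).
- move=> a; exists (fun ij => al a ij.1 ij.2 / d.+1%:R).
  rewrite [LHS](unit_span fdM oe ae e1 ve vv) pair_bigA /=.
  by apply: eq_bigr => ij _; rewrite scalerA divfK.
- exact: PsiH.
- by move=> a i; rewrite /= Pd pi_tr.
- move=> [i j] k l /=.
  have [PsiL _ _ _] := PsiH.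
  have Psi0 : Psi (pi 0) = 0.
    have /= := PsiL 1 0 0; rewrite scale1r addr0 scale1r => /eqP.
    by rewrite -subr_eq0 opprD addNKr oppr_eq0 => /eqP.
  have /= := PsiL d.+1%:R (v i * star (v j)) 0; rewrite addr0 => ->.
  rewrite Psi0 addr0 mxE; apply: Pi => x y.
  rewrite mxE /al (coef_unit fdM oe ae ev ve v_v) -natrM.
  exact: algebraic_integer_nat.
Qed.
End FiniteDimensional.

Unset Implicit Arguments.

Theorem theorem3p11 (R : realType) :
  (forall (M1 M2 : tracialVnAlg R) (q : rat) (q01 : 0 < q < 1),
     algebraically_sofic M1 -> algebraically_sofic M2 ->
     algebraically_sofic (tracial_sum M1 M2 q01)) /\
  (forall M : tracialVnAlg R,
     finite_dimensional M ->
     (forall p : M, central_projection p -> exists r : rat, tau p = ratr r) ->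
     algebraically_sofic M).
Proof.
split; first exact: algebraically_sofic_sum.
by move=> M; exact: algebraically_sofic_finite_dimensional.
Qed.
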